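(* Let $\mathcal{H}$ be a separable complex Hilbert space and let $E=(E_{n,k})_{n,k\ge1}$ be an invertible infinite matrix mapping on $\bigoplus_{n=1}^\infty\mathcal{H}$. Let $\{f_k\}_{k=1}^\infty$ be an $E$-frame for $\mathcal{H}$ with synthesis operator $T_E$. Then for every $\varepsilon\in(0,1)$ there exist a bounded linear surjection $T:\mathcal{H}\to\mathcal{H}$ and three $E$-orthonormal bases $\{g^1_k\}_{k=1}^\infty$, $\{g^2_k\}_{k=1}^\infty$, $\{g^3_k\}_{k=1}^\infty$ for $\mathcal{H}$ such that $$E\{f_k\}_{k=1}^\infty=\frac{\|T\|}{1-\varepsilon}\Big(E\{g^1_k\}_{k=1}^\infty+E\{g^2_k\}_{k=1}^\infty+E\{g^3_k\}_{k=1}^\infty\Big).$$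
   Context: $\bigoplus_{n=1}^\infty\mathcal{H}$ is the space of sequences $\{f_k\}$ in $\mathcal{H}$ with $\sum_k\|f_k\|^2<\infty$. An infinite matrix $E$ acts on sequences by $E\{f_k\}_{k=1}^\infty=\{\sum_{k=1}^\infty E_{n,k}f_k\}_{n=1}^\infty$, writing $(E\{f_k\})_n=\sum_kE_{n,k}f_k$; $E$ is an invertible matrix mapping on $\bigoplus\mathcal{H}$ if this defines a bijection of $\bigoplus_{n=1}^\infty\mathcal{H}$ onto itself. A sequence $\{f_k\}$ is an $E$-frame if there are $0<A\le B<\infty$ with $A\|f\|^2\le\sum_n|\langle f,(E\{f_k\})_n\rangle|^2\le B\|f\|^2$ for all $f\in\mathcal{H}$; its synthesis (pre-$E$-frame) operator is $T_E:\ell^2(\mathbb{N})\to\mathcal{H}$, $T_E\{c_n\}=\sum_n c_n(E\{f_k\})_n$. A sequence $\{g_k\}$ is an $E$-basis if every $f\in\mathcal{H}$ has unique scalars $\{c_k(f)\}$ with $f=\sum_k c_k(f)(E\{g_j\})_k$; it is an $E$-orthonormal basis if moreover $\langle (E\{g_j\})_n,(E\{g_j\})_k\rangle=\delta_{n,k}$ for all $n,k$. $\|T\|$ is the operator norm.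
   Formalization: The Hilbert space is assumed infinite-dimensional; in finite dimension no E-orthonormal basis indexed by all k ≥ 1 exists, so the claim fails there (e.g. H = ℂ, E the identity matrix, f = (1,0,0,…)). *)

(* Defs.v *)
From Stdlib Require Import Reals Lra.
From Coquelicot Require Import Coquelicot.
Open Scope R_scope.

Record HilbertSpace := {
  hcar :> Type;
  hzero : hcar;
  hadd : hcar -> hcar -> hcar;
  hopp : hcar -> hcar;
  hscal : C -> hcar -> hcar;
  hinner : hcar -> hcar -> C;
  hadd_assoc : forall x y z, hadd x (hadd y z) = hadd (hadd x y) z;
  hadd_comm : forall x y, hadd x y = hadd y x;
  hadd_zero : forall x, hadd x hzero = x;
  hadd_opp : forall x, hadd x (hopp x) = hzero;
  hscal_assoc : forall a b x, hscal a (hscal b x) = hscal (Cmult a b) x;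
  hscal_one : forall x, hscal (RtoC 1) x = x;
  hscal_distr_l : forall a x y, hscal a (hadd x y) = hadd (hscal a x) (hscal a y);
  hscal_distr_r : forall a b x, hscal (Cplus a b) x = hadd (hscal a x) (hscal b x);
  hinner_add_l : forall x y z, hinner (hadd x y) z = Cplus (hinner x z) (hinner y z);
  hinner_scal_l : forall a x y, hinner (hscal a x) y = Cmult a (hinner x y);
  hinner_conj : forall x y, hinner y x = Cconj (hinner x y);
  hinner_pos : forall x, 0 <= Re (hinner x x);
  hinner_def : forall x, hinner x x = RtoC 0 -> x = hzero
}.

Section HDefs.
Variable H : HilbertSpace.

Definition hsub (x y : H) : H := hadd H x (hopp H y).
Definition hnorm (x : H) : R := sqrt (Re (hinner H x x)).

Fixpoint hpsum (u : nat -> H) (N : nat) : H :=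
  match N with
  | O => hzero H
  | S N' => hadd H (hpsum u N') (u N')
  end.

Definition has_sum (u : nat -> H) (s : H) : Prop :=
  is_lim_seq (fun N => hnorm (hsub s (hpsum u N))) 0.

Definition complete : Prop :=
  forall u : nat -> H,
    (forall eps, 0 < eps -> exists N, forall m n, (N <= m)%nat -> (N <= n)%nat ->
        hnorm (hsub (u m) (u n)) < eps) ->
    exists l, is_lim_seq (fun n => hnorm (hsub (u n) l)) 0.

Definition separable : Prop :=
  exists d : nat -> H, forall x eps, 0 < eps -> exists n, hnorm (hsub x (d n)) < eps.

Definition infinite_dimensional : Prop :=
  forall (n : nat) (v : nat -> H), exists x : H,
    forall c : nat -> C, x <> hpsum (fun k => hscal H (c k) (v k)) n.

Definition in_l2H (F : nat -> H) : Prop := ex_series (fun k => (hnorm (F k))^2).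

Definition mat_apply (E : nat -> nat -> C) (F EF : nat -> H) : Prop :=
  forall n, has_sum (fun k => hscal H (E n k) (F k)) (EF n).

Definition invertible_matrix_mapping (E : nat -> nat -> C) : Prop :=
  (forall F, in_l2H F -> exists EF, mat_apply E F EF /\ in_l2H EF) /\
  (forall F1 F2 G, in_l2H F1 -> in_l2H F2 -> mat_apply E F1 G -> mat_apply E F2 G ->
     forall k, F1 k = F2 k) /\
  (forall G, in_l2H G -> exists F, in_l2H F /\ mat_apply E F G).

Definition E_frame (E : nat -> nat -> C) (f : nat -> H) : Prop :=
  exists Ef, mat_apply E f Ef /\
  exists A B, 0 < A /\ A <= B /\
    forall x : H,
      ex_series (fun n => (Cmod (hinner H x (Ef n)))^2) /\
      A * (hnorm x)^2 <= Series (fun n => (Cmod (hinner H x (Ef n)))^2) /\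
      Series (fun n => (Cmod (hinner H x (Ef n)))^2) <= B * (hnorm x)^2.

Definition E_basis (E : nat -> nat -> C) (g : nat -> H) : Prop :=
  exists Eg, mat_apply E g Eg /\
    forall x : H,
      (exists c : nat -> C, has_sum (fun k => hscal H (c k) (Eg k)) x) /\
      (forall c d : nat -> C, has_sum (fun k => hscal H (c k) (Eg k)) x ->
          has_sum (fun k => hscal H (d k) (Eg k)) x -> forall k, c k = d k).

Definition E_orthonormal_basis (E : nat -> nat -> C) (g : nat -> H) : Prop :=
  E_basis E g /\
  forall Eg, mat_apply E g Eg ->
    forall n k, hinner H (Eg n) (Eg k) = RtoC (if Nat.eqb n k then 1 else 0).

Definition bounded_linear (T : H -> H) : Prop :=
  (forall x y, T (hadd H x y) = hadd H (T x) (T y)) /\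
  (forall a x, T (hscal H a x) = hscal H a (T x)) /\
  (exists M, forall x, hnorm (T x) <= M * hnorm x).

Definition surjective (T : H -> H) : Prop := forall y, exists x, T x = y.

Definition opnorm (T : H -> H) : R :=
  real (Lub_Rbar (fun r => exists x, hnorm x <= 1 /\ r = hnorm (T x))).

End HDefs.

(* Main.v *)
(* Let [e] be an orthonormal basis of [H], let [u n] be the [n]-th term of [E f] and let [S] be
   the bounded operator with [S (e n) = u n].  As only [||T||] enters the conclusion, [T] can be
   taken to be a large multiple of the identity, so that it suffices to write the operator
   [X = S / l], of small norm, as a sum of three unitaries and to realise the images of [e] under
   these unitaries as [E g].

   Unitaries: with [V = (1 + X) / 2] and [V* V = (1 + R) / 4], the operator
   [K = ((V* V)^-1 - 1)^(1/2)], close to [sqrt 3], commutes with [R] and makes [V (1 + i K)] and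
   [V (1 - i K)] unitary; their sum is [1 + X], and the third unitary is [-1].  [K] is obtained
   from a contraction, without spectral theory.

   Realisation: an orthonormal basis is not square summable, so surjectivity of [E] does not
   apply to it directly.  In coordinates, [E] is a bijection of [l^2] whose inverse is bounded by
   the closed graph theorem, and the adjoint of this inverse sends [e] to the required [g]. *)

Require Import Defs.
From Stdlib Require Import Reals Lra Lia Classical ClassicalEpsilon.
From Coquelicot Require Import Coquelicot.
Open Scope R_scope.

(** * Finite sums, series of nonnegative terms and limits of complex sequences *)

Fixpoint rsum (a : nat -> R) (N : nat) : R :=
  match N with O => 0 | S N' => rsum a N' + a N' end.

Fixpoint csum (a : nat -> C) (N : nat) : C :=
  match N with O => RtoC 0 | S N' => Cplus (csum a N') (a N') end.

Lemma rsum_ext a b N : (forall k, a k = b k) -> rsum a N = rsum b N.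
Proof. intros Hab; induction N; simpl; rewrite ?IHN, ?Hab; auto. Qed.

Lemma csum_ext a b N : (forall k, a k = b k) -> csum a N = csum b N.
Proof. intros Hab; induction N; simpl; rewrite ?IHN, ?Hab; auto. Qed.

Lemma rsum_sum_n a N : rsum a (S N) = sum_n a N.
Proof.
  induction N.
  - rewrite sum_O; simpl; ring.
  - rewrite sum_Sn, <- IHN; reflexivity.
Qed.

Lemma rsum_le_mono a n m : (forall k, 0 <= a k) -> (n <= m)%nat -> rsum a n <= rsum a m.
Proof.
  intros Ha; induction 1; simpl; [lra | specialize (Ha m); lra].
Qed.

Lemma rsum_le_Series a N : (forall k, 0 <= a k) -> ex_series a -> rsum a N <= Series a.
Proof.
  intros Ha Hs.
  apply (is_lim_seq_le_loc (fun _ => rsum a N) (sum_n a) (rsum a N) (Series a)).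
  - exists N; intros n Hn; rewrite <- rsum_sum_n; apply rsum_le_mono; auto; lia.
  - apply is_lim_seq_const.
  - apply Series_correct; auto.
Qed.

Lemma ex_series_rsum_bounded a M :
  (forall k, 0 <= a k) -> (forall N, rsum a N <= M) -> ex_series a.
Proof.
  intros Ha HM.
  destruct (ex_finite_lim_seq_incr (sum_n a) M) as [l Hl].
  - intros n; rewrite sum_Sn; unfold plus; simpl; specialize (Ha (S n)); lra.
  - intros n; rewrite <- rsum_sum_n; auto.
  - exists l; exact Hl.
Qed.

Lemma rsum_cauchy a M :
  (forall k, 0 <= a k) -> (forall N, rsum a N <= M) ->
  forall eps, 0 < eps -> exists N, forall n m, (N <= n)%nat -> (N <= m)%nat ->
    Rabs (rsum a n - rsum a m) < eps.
Proof.
  intros Ha HM eps Heps.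
  destruct (ex_finite_lim_seq_incr (rsum a) M) as [l Hl]; auto.
  - intros n; simpl; specialize (Ha n); lra.
  - destruct (proj1 (ex_lim_seq_cauchy_corr (rsum a)) (ex_intro _ l Hl) (mkposreal _ Heps))
      as [N HN].
    exists N; intros n m Hn Hm; apply HN; auto.
Qed.

Lemma Cconj_RtoC r : Cconj (RtoC r) = RtoC r.
Proof. unfold Cconj, RtoC; simpl; f_equal; ring. Qed.

Lemma Cmod_sqr_re c : Cmod c ^ 2 = Re (Cmult c (Cconj c)).
Proof. rewrite <- Cmod2_conj; reflexivity. Qed.

Definition clim (z : nat -> C) (w : C) : Prop :=
  is_lim_seq (fun n => Cmod (Cminus (z n) w)) 0.

Lemma is_lim_seq_0_le (u v : nat -> R) :
  (forall n, 0 <= u n <= v n) -> is_lim_seq v 0 -> is_lim_seq u 0.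
Proof.
  intros Huv Hv; apply (is_lim_seq_le_le (fun _ => 0) u v); auto.
  apply is_lim_seq_const.
Qed.

Lemma is_lim_seq_0_scal (u : nat -> R) (M : R) :
  is_lim_seq u 0 -> is_lim_seq (fun n => M * u n) 0.
Proof.
  intros Hu; replace (Finite 0) with (Rbar_mult M 0) by (simpl; f_equal; ring).
  apply is_lim_seq_scal_l; auto.
Qed.

Lemma is_lim_seq_0_plus (u v : nat -> R) :
  is_lim_seq u 0 -> is_lim_seq v 0 -> is_lim_seq (fun n => u n + v n) 0.
Proof.
  intros Hu Hv; replace (Finite 0) with (Finite (0 + 0)) by (f_equal; ring).
  apply is_lim_seq_plus'; auto.
Qed.

Lemma is_lim_seq_const_0_le (r : R) (v : nat -> R) :
  (forall n, r <= v n) -> is_lim_seq v 0 -> r <= 0.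
Proof.
  intros Hr Hv; apply (is_lim_seq_le (fun _ => r) v r 0); auto.
  apply is_lim_seq_const.
Qed.

Lemma clim_unique z w1 w2 : clim z w1 -> clim z w2 -> w1 = w2.
Proof.
  intros H1 H2.
  assert (Hd : Cmod (Cminus w1 w2) <= 0).
  { refine (is_lim_seq_const_0_le _ _ _ (is_lim_seq_0_plus _ _ H1 H2)).
    intros n; simpl.
    replace (Cminus w1 w2) with (Cplus (Copp (Cminus (z n) w1)) (Cminus (z n) w2)) by ring.
    eapply Rle_trans; [apply Cmod_triangle | rewrite Cmod_opp; lra]. }
  assert (H0 : Cmod (Cminus w1 w2) = 0) by (pose proof (Cmod_ge_0 (Cminus w1 w2)); lra).
  apply Cmod_eq_0 in H0; apply Ceq_minus; exact H0.
Qed.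

Lemma clim_const w : clim (fun _ => w) w.
Proof.
  unfold clim; eapply is_lim_seq_ext; [| apply is_lim_seq_const].
  intros n; simpl; replace (Cminus w w) with (RtoC 0) by ring; rewrite Cmod_0; auto.
Qed.

Lemma clim_ext z z' w : (forall n, z n = z' n) -> clim z w -> clim z' w.
Proof. intros Hz; apply is_lim_seq_ext; intros n; rewrite Hz; auto. Qed.

Lemma clim_bounded z w : clim z w -> exists M, forall n, Cmod (z n) <= M.
Proof.
  intros Hz.
  destruct (filterlim_bounded (fun n => Cmod (Cminus (z n) w))) as [M HM];
    [exists 0; exact Hz|].
  exists (M + Cmod w); intros n.
  replace (z n) with (Cplus (Cminus (z n) w) w) by ring.
  eapply Rle_trans; [apply Cmod_triangle|].
  specialize (HM n); unfold norm in HM; simpl in HM; unfold abs in HM; simpl in HM.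
  pose proof (Rle_abs (Cmod (Cminus (z n) w))); lra.
Qed.

(** Recursion for Gram-Schmidt, where each choice depends on all earlier ones. As [P n] sees its
    sequence only below [n], the value at [n] can be chosen from the finite table [pre n], which
    agrees with [e] there. *)
Lemma course_of_values_choice (A : Type) (a0 : A) (P : nat -> (nat -> A) -> A -> Prop) :
  (forall n p q v, (forall k, (k < n)%nat -> p k = q k) -> P n p v -> P n q v) ->
  (forall n p, (forall k, (k < n)%nat -> P k p (p k)) -> exists v, P n p v) ->
  exists e, forall n, P n e (e n).
Proof.
  intros Hext Hstep.
  set (step := fun n p => epsilon (inhabits a0) (P n p)).
  set (pre := fix pre n : nat -> A := match n with
    | O => fun _ => a0
    | S m => fun k => if Nat.eqb k m then step m (pre m) else pre m k end).
  set (e := fun n => step n (pre n)).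
  assert (Hpre : forall n k, (k < n)%nat -> pre n k = e k).
  { induction n as [| n IH]; intros k Hk; [lia |]; simpl.
    destruct (Nat.eqb_spec k n) as [-> | Hkn]; [reflexivity | apply IH; lia]. }
  exists e; intros n; induction n as [n IH] using (well_founded_induction Wf_nat.lt_wf).
  apply (Hext n (pre n)); [auto |].
  apply (epsilon_spec (inhabits a0) (P n (pre n))), Hstep.
  intros k Hk; rewrite Hpre by auto; apply (Hext k e); auto.
  intros j Hj; rewrite Hpre; auto; lia.
Qed.

Local Notation "x [+] y" := (hadd _ x y) (at level 50, left associativity).
Local Notation "x [-] y" := (hsub _ x y) (at level 50, left associativity).
Local Notation "a [*] x" := (hscal _ a x) (at level 40, left associativity).
Local Notation "<| x , y |>" := (hinner _ x y) (at level 0, format "<| x ,  y |>").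
Local Notation "|[ x ]|" := (hnorm _ x) (at level 0, format "|[ x ]|").

(** * Inner product and norm *)

Section InnerProduct.
Context {H : HilbertSpace}.

Lemma hinner_zero_l (y : H) : <|hzero H, y|> = RtoC 0.
Proof.
  pose proof (hinner_add_l H (hzero H) (hzero H) y) as Hz.
  rewrite hadd_zero in Hz.
  transitivity (Cminus <|hzero H, y|> <|hzero H, y|>); [rewrite Hz at 2 |]; ring.
Qed.

Lemma hinner_opp_l (x y : H) : <|hopp H x, y|> = Copp <|x, y|>.
Proof.
  pose proof (hinner_add_l H x (hopp H x) y) as Hz.
  rewrite hadd_opp, hinner_zero_l in Hz.
  transitivity (Cminus (Cplus <|x, y|> <|hopp H x, y|>) <|x, y|>); [| rewrite <- Hz]; ring.
Qed.

Lemma hinner_sub_l (x y z : H) : <|x [-] y, z|> = Cminus <|x, z|> <|y, z|>.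
Proof. unfold hsub; rewrite hinner_add_l, hinner_opp_l; reflexivity. Qed.

Lemma hinner_add_r (x y z : H) : <|z, x [+] y|> = Cplus <|z, x|> <|z, y|>.
Proof.
  rewrite (hinner_conj H (x [+] y) z), hinner_add_l, Cplus_conj, <- !hinner_conj; auto.
Qed.

Lemma hinner_scal_r a (x z : H) : <|z, a [*] x|> = Cmult (Cconj a) <|z, x|>.
Proof. rewrite (hinner_conj H (a [*] x) z), hinner_scal_l, Cmult_conj, <- hinner_conj; auto. Qed.

Lemma hinner_zero_r (z : H) : <|z, hzero H|> = RtoC 0.
Proof. rewrite (hinner_conj H (hzero H) z), hinner_zero_l, Cconj_RtoC; auto. Qed.

Lemma hinner_opp_r (x z : H) : <|z, hopp H x|> = Copp <|z, x|>.
Proof. rewrite (hinner_conj H (hopp H x) z), hinner_opp_l, Copp_conj, <- hinner_conj; auto. Qed.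

Lemma hinner_sub_r (x y z : H) : <|z, x [-] y|> = Cminus <|z, x|> <|z, y|>.
Proof. unfold hsub; rewrite hinner_add_r, hinner_opp_r; auto. Qed.

Lemma hadd_opp_eq (x y : H) : hadd H x (hopp H y) = hzero H -> x = y.
Proof.
  intros Hxy; rewrite <- (hadd_zero H x), <- (hadd_opp H y), (hadd_comm H y).
  rewrite hadd_assoc, Hxy, hadd_comm, hadd_zero; auto.
Qed.

Lemma hinner_ext (x y : H) : (forall z, <|x, z|> = <|y, z|>) -> x = y.
Proof.
  intros Hxy; apply hadd_opp_eq, hinner_def.
  rewrite hinner_add_l, hinner_opp_l, Hxy; ring.
Qed.

Lemma hinner_self (x : H) : <|x, x|> = RtoC (|[x]| ^ 2).
Proof.
  unfold hnorm; rewrite pow2_sqrt by apply hinner_pos.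
  pose proof (hinner_conj H x x) as Hc.
  destruct <|x, x|> as [a b]; unfold Cconj, RtoC in *; simpl in *.
  injection Hc; intros Hb; f_equal; lra.
Qed.

Lemma hnorm_sqr (x : H) : |[x]| ^ 2 = Re <|x, x|>.
Proof. rewrite hinner_self; auto. Qed.

Lemma hnorm_pos (x : H) : 0 <= |[x]|.
Proof. apply sqrt_pos. Qed.

End InnerProduct.

Ltac inner_simpl :=
  rewrite ?hinner_add_l, ?hinner_sub_l, ?hinner_opp_l, ?hinner_scal_l, ?hinner_zero_l,
    ?hinner_add_r, ?hinner_sub_r, ?hinner_opp_r, ?hinner_scal_r, ?hinner_zero_r.

(* Vector identities are checked after pairing both sides with an arbitrary vector. *)
Ltac hilb :=
  apply hinner_ext; let z := fresh in intros z;
  repeat progress inner_simpl; try ring.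

Section Hilbert.
Context {H : HilbertSpace}.

Lemma hnorm_eq_zero (x : H) : |[x]| = 0 -> x = hzero H.
Proof. intros Hx; apply hinner_def; rewrite hinner_self, Hx; f_equal; ring. Qed.

Lemma hnorm_zero : |[hzero H]| = 0.
Proof. unfold hnorm; rewrite hinner_zero_l; apply sqrt_0. Qed.

Lemma hsub_eq_zero (x y : H) : x [-] y = hzero H -> x = y.
Proof. apply hadd_opp_eq. Qed.

Lemma hnorm_scal a (x : H) : |[a [*] x]| = Cmod a * |[x]|.
Proof.
  apply Rsqr_inj.
  - apply hnorm_pos.
  - apply Rmult_le_pos; [apply Cmod_ge_0 | apply hnorm_pos].
  - rewrite Rsqr_mult, !Rsqr_pow2, hnorm_sqr, Cmod_sqr_re.
    inner_simpl; rewrite hinner_self, Cmult_assoc, re_scal_r; ring.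
Qed.

Lemma hnorm_sub_sym (x y : H) : |[x [-] y]| = |[y [-] x]|.
Proof.
  replace (x [-] y) with (Copp (RtoC 1) [*] (y [-] x)) by hilb.
  rewrite hnorm_scal, Cmod_opp, Cmod_1; ring.
Qed.

Lemma cauchy_schwarz (x y : H) : Cmod <|x, y|> <= |[x]| * |[y]|.
Proof.
  destruct (Req_dec (|[y]|) 0) as [Hy | Hy].
  { rewrite (hnorm_eq_zero y Hy), hinner_zero_r, Cmod_0, hnorm_zero; lra. }
  assert (Hyp : 0 < |[y]|) by (pose proof (hnorm_pos y); lra).
  (* This is [|[y]| ^ 2] times the component of [x] orthogonal to [y], scaled so that no division
     occurs; the inequality is the positivity of [<|w, w|>]. *)
  set (w := RtoC (|[y]| ^ 2) [*] x [-] <|x, y|> [*] y).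
  assert (Hw : <|w, w|> =
    RtoC (|[y]| ^ 2 * (|[y]| ^ 2 * |[x]| ^ 2 - Cmod <|x, y|> ^ 2))).
  { unfold w; repeat progress inner_simpl.
    rewrite RtoC_mult, RtoC_minus, RtoC_mult, Cmod2_conj, Cconj_RtoC.
    rewrite (hinner_self y), (hinner_self x), (hinner_conj H x y); ring. }
  pose proof (hinner_pos H w) as Hp; rewrite Hw in Hp; simpl Re in Hp.
  assert (0 < |[y]| ^ 2) by (apply pow_lt; auto).
  assert (Hd : Cmod <|x, y|> ^ 2 <= (|[x]| * |[y]|) ^ 2) by nra.
  apply Rsqr_incr_0_var; [rewrite !Rsqr_pow2; auto |].
  apply Rmult_le_pos; apply hnorm_pos.
Qed.

Lemma hnorm_triangle (x y : H) : |[x [+] y]| <= |[x]| + |[y]|.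
Proof.
  apply Rsqr_incr_0_var.
  - rewrite !Rsqr_pow2, hnorm_sqr; repeat progress inner_simpl.
    rewrite !re_plus, (hinner_conj H x y), re_conj, <- !hnorm_sqr.
    pose proof (cauchy_schwarz x y); pose proof (re_le_Cmod <|x, y|>).
    pose proof (Rle_abs (Re <|x, y|>)); nra.
  - pose proof (hnorm_pos x); pose proof (hnorm_pos y); lra.
Qed.

Lemma hnorm_sub_triangle (y x z : H) : |[x [-] z]| <= |[x [-] y]| + |[y [-] z]|.
Proof.
  replace (x [-] z) with ((x [-] y) [+] (y [-] z)) by hilb; apply hnorm_triangle.
Qed.

Lemma hnorm_sub_le (x y : H) : |[x [-] y]| <= |[x]| + |[y]|.
Proof.
  replace (x [-] y) with (x [+] Copp (RtoC 1) [*] y) by hilb.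
  eapply Rle_trans; [apply hnorm_triangle |].
  rewrite hnorm_scal, Cmod_opp, Cmod_1; lra.
Qed.

Lemma hnorm_le_sub (x y : H) : |[x]| <= |[x [-] y]| + |[y]|.
Proof.
  replace x with ((x [-] y) [+] y) at 1 by hilb; apply hnorm_triangle.
Qed.

(** Cancels one factor [|[x]|]. The zero case remains as an alternative because [M] may be
    negative. *)
Lemma hnorm_le_of_sqr (x : H) M : |[x]| ^ 2 <= M * |[x]| -> |[x]| <= M \/ |[x]| = 0.
Proof.
  intros Hx; destruct (Req_dec (|[x]|) 0); auto; left.
  pose proof (hnorm_pos x); nra.
Qed.

Lemma hnorm_le_pairing (x : H) M :
  0 <= M -> (forall y, Cmod <|x, y|> <= M * |[y]|) -> |[x]| <= M.
Proof.
  intros HM Hx; specialize (Hx x).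
  rewrite hinner_self, Cmod_R, Rabs_pos_eq in Hx by apply pow2_ge_0.
  destruct (hnorm_le_of_sqr x M Hx) as [| ->]; auto.
Qed.

(** * Norm limits and geometric convergence *)

Definition hlim (u : nat -> H) (l : H) : Prop :=
  is_lim_seq (fun n => |[u n [-] l]|) 0.

Lemma hlim_eps u l : hlim u l ->
  forall eps, 0 < eps -> exists N, forall n, (N <= n)%nat -> |[u n [-] l]| < eps.
Proof.
  intros Hu eps Heps; apply is_lim_seq_spec in Hu.
  destruct (Hu (mkposreal eps Heps)) as [N HN]; exists N; intros n Hn.
  specialize (HN n Hn); simpl in HN; rewrite Rminus_0_r in HN.
  pose proof (Rle_abs (|[u n [-] l]|)); lra.
Qed.

Lemma hlim_of_eps u l :
  (forall eps, 0 < eps -> exists N, forall n, (N <= n)%nat -> |[u n [-] l]| < eps) ->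
  hlim u l.
Proof.
  intros Hu; apply is_lim_seq_spec; intros [eps Heps]; simpl.
  destruct (Hu eps Heps) as [N HN]; exists N; intros n Hn.
  rewrite Rminus_0_r, Rabs_pos_eq by apply hnorm_pos; auto.
Qed.

Lemma hlim_unique u l1 l2 : hlim u l1 -> hlim u l2 -> l1 = l2.
Proof.
  intros H1 H2; apply hsub_eq_zero, hnorm_eq_zero.
  assert (|[l1 [-] l2]| <= 0).
  { refine (is_lim_seq_const_0_le _ _ _ (is_lim_seq_0_plus _ _ H1 H2)); intros n; simpl.
    eapply Rle_trans; [apply (hnorm_sub_triangle (u n)) |].
    rewrite (hnorm_sub_sym l1); lra. }
  pose proof (hnorm_pos (l1 [-] l2)); lra.
Qed.

Lemma hlim_ext u v l : (forall n, u n = v n) -> hlim u l -> hlim v l.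
Proof. intros Huv; apply is_lim_seq_ext; intros n; rewrite Huv; auto. Qed.

Lemma hlim_le u l (r : nat -> R) :
  (forall n, |[u n [-] l]| <= r n) -> is_lim_seq r 0 -> hlim u l.
Proof. intros Hr; apply is_lim_seq_0_le; intros n; split; [apply hnorm_pos | apply Hr]. Qed.

Lemma hlim_incr u l : hlim u l -> hlim (fun n => u (S n)) l.
Proof. intros Hu; apply (is_lim_seq_incr_1 (fun n => |[u n [-] l]|)); auto. Qed.

Lemma hlim_add u v l m : hlim u l -> hlim v m -> hlim (fun n => u n [+] v n) (l [+] m).
Proof.
  intros Hu Hv; eapply hlim_le; [| exact (is_lim_seq_0_plus _ _ Hu Hv)]; intros n; simpl.
  replace (u n [+] v n [-] (l [+] m)) with ((u n [-] l) [+] (v n [-] m)) by hilb.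
  apply hnorm_triangle.
Qed.

Lemma hlim_inner u l x : hlim u l -> clim (fun n => <|u n, x|>) <|l, x|>.
Proof.
  intros Hu; apply (is_lim_seq_0_le _ (fun n => |[x]| * |[u n [-] l]|)).
  - intros n; split; [apply Cmod_ge_0 |].
    rewrite <- hinner_sub_l, Rmult_comm; apply cauchy_schwarz.
  - apply is_lim_seq_0_scal; auto.
Qed.

Lemma hlim_norm_le u l M : hlim u l -> (forall n, |[u n]| <= M) -> |[l]| <= M.
Proof.
  intros Hu HM; assert (|[l]| - M <= 0); [| lra].
  refine (is_lim_seq_const_0_le _ _ _ Hu); intros n; simpl; specialize (HM n).
  pose proof (hnorm_le_sub l (u n)) as Ht; rewrite hnorm_sub_sym in Ht; lra.
Qed.

Lemma has_sum_hlim u s : has_sum H u s <-> hlim (hpsum H u) s.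
Proof.
  split; apply is_lim_seq_ext; intros n; apply hnorm_sub_sym.
Qed.

(** A telescoping sum; the difference [q ^ n - q ^ m] makes the induction on [m] exact. *)
Lemma geometric_tail (u : nat -> H) K q : 0 <= K -> 0 <= q < 1 ->
  (forall n, |[u (S n) [-] u n]| <= K * q ^ n) ->
  forall n m, (n <= m)%nat -> |[u m [-] u n]| <= K / (1 - q) * (q ^ n - q ^ m).
Proof.
  intros HK Hq Hu n m; induction 1 as [| m Hm IH].
  - replace (u n [-] u n) with (hzero H) by hilb; rewrite hnorm_zero; lra.
  - eapply Rle_trans; [apply (hnorm_sub_triangle (u m)) |].
    specialize (Hu m).
    replace (K / (1 - q) * (q ^ n - q ^ S m))
      with (K / (1 - q) * (q ^ n - q ^ m) + K * q ^ m) by (simpl; field; lra).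
    lra.
Qed.

(** The rate is recorded along with the limit, since the gliding hump and the square root iteration
    estimate the distance from the limit to each iterate. *)
Lemma geometric_limit (u : nat -> H) K q : complete H -> 0 <= K -> 0 <= q < 1 ->
  (forall n, |[u (S n) [-] u n]| <= K * q ^ n) ->
  exists l, hlim u l /\ forall n, |[l [-] u n]| <= K / (1 - q) * q ^ n.
Proof.
  intros Hc HK Hq Hu; pose proof (geometric_tail u K q HK Hq Hu) as Ht.
  assert (HKq : 0 <= K / (1 - q)) by (apply Rdiv_le_0_compat; lra).
  assert (Hle : forall n m, (n <= m)%nat -> |[u m [-] u n]| <= K / (1 - q) * q ^ n).
  { intros n m Hnm; eapply Rle_trans; [apply Ht; auto |].
    apply Rmult_le_compat_l; auto; assert (0 <= q ^ m) by (apply pow_le; lra); lra. }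
  destruct (Hc u) as [l Hl].
  - intros eps Heps.
    assert (Hg : is_lim_seq (fun n => K / (1 - q) * q ^ n) 0).
    { apply is_lim_seq_0_scal, is_lim_seq_geom; rewrite Rabs_pos_eq; lra. }
    apply is_lim_seq_spec in Hg; destruct (Hg (mkposreal eps Heps)) as [N HN].
    exists N; intros m n Hm Hn.
    destruct (Nat.le_ge_cases m n) as [Hmn | Hmn]; [rewrite hnorm_sub_sym |];
      (eapply Rle_lt_trans; [apply Hle; auto |]).
    + specialize (HN m Hm); simpl in HN; rewrite Rminus_0_r in HN.
      eapply Rle_lt_trans; [apply Rle_abs | exact HN].
    + specialize (HN n Hn); simpl in HN; rewrite Rminus_0_r in HN.
      eapply Rle_lt_trans; [apply Rle_abs | exact HN].
  - exists l; split; auto; intros n.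
    assert (|[l [-] u n]| - K / (1 - q) * q ^ n <= 0); [| lra].
    (* The convergent sequence is shifted by [n], so that the tail estimate applies to every
       index. *)
    refine (is_lim_seq_const_0_le _ _ _ (proj1 (is_lim_seq_incr_n _ n _) Hl)); intros m; simpl.
    pose proof (Hle n (m + n)%nat ltac:(lia)).
    pose proof (hnorm_sub_triangle (u (m + n)%nat) l (u n)) as H3.
    rewrite (hnorm_sub_sym l (u (m + n)%nat)) in H3; lra.
Qed.

(** * Orthonormal systems *)

Lemma hpsum_ext (u v : nat -> H) N :
  (forall k, (k < N)%nat -> u k = v k) -> hpsum H u N = hpsum H v N.
Proof.
  induction N as [| N IH]; intros Huv; simpl; auto.
  rewrite (Huv N), IH; auto.
Qed.

Lemma hinner_hpsum_l (u : nat -> H) N x : <|hpsum H u N, x|> = csum (fun k => <|u k, x|>) N.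
Proof. induction N; simpl; inner_simpl; rewrite ?IHN; auto. Qed.

Lemma hpsum_scal (c : nat -> C) (h : H) N :
  hpsum H (fun k => c k [*] h) N = csum c N [*] h.
Proof. induction N; simpl; rewrite ?IHN; hilb. Qed.

(** * Linear maps and adjoints *)

Definition linear_map (T : H -> H) : Prop :=
  (forall x y, T (x [+] y) = T x [+] T y) /\ (forall a x, T (a [*] x) = a [*] T x).

Lemma linear_map_sub T x y : linear_map T -> T (x [-] y) = T x [-] T y.
Proof.
  intros [Ha Hs].
  replace (x [-] y) with (x [+] Copp (RtoC 1) [*] y) by hilb; rewrite Ha, Hs; hilb.
Qed.

Lemma linear_map_zero T : linear_map T -> T (hzero H) = hzero H.
Proof.
  intros HT; replace (hzero H) with (hzero H [-] hzero H) at 1 by hilb.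
  rewrite linear_map_sub by auto; hilb.
Qed.

Lemma linear_map_hpsum T u N : linear_map T -> T (hpsum H u N) = hpsum H (fun k => T (u k)) N.
Proof.
  intros HT; induction N; simpl; [apply linear_map_zero; auto |].
  rewrite (proj1 HT), IHN; auto.
Qed.

Lemma hlim_linear T M u l : linear_map T -> (forall x, |[T x]| <= M * |[x]|) ->
  hlim u l -> hlim (fun n => T (u n)) (T l).
Proof.
  intros HT HM Hu; eapply hlim_le; [| exact (is_lim_seq_0_scal _ M Hu)]; intros n; simpl.
  rewrite <- linear_map_sub; auto.
Qed.

Definition adjoint (A B : H -> H) : Prop := forall x y, <|A x, y|> = <|x, B y|>.

Lemma adjoint_sym A B : adjoint A B -> adjoint B A.
Proof. intros HAB x y; rewrite (hinner_conj H y (B x)), <- HAB, <- hinner_conj; auto. Qed.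

(** Paired with [z], the vector [A x] becomes the pairing of [x] with the fixed vector [B z], which
    is linear in [x]. *)
Lemma adjoint_linear A B : adjoint A B -> linear_map A.
Proof.
  intros HAB; split; intros; apply hinner_ext; intros z;
    inner_simpl; rewrite !HAB; inner_simpl; auto.
Qed.

Lemma adjoint_bound A B M : 0 <= M -> adjoint A B ->
  (forall x, |[A x]| <= M * |[x]|) -> forall y, |[B y]| <= M * |[y]|.
Proof.
  intros HM HAB HA y; apply hnorm_le_pairing.
  - apply Rmult_le_pos; auto; apply hnorm_pos.
  - intros x; rewrite (adjoint_sym _ _ HAB).
    eapply Rle_trans; [apply cauchy_schwarz |].
    pose proof (Rmult_le_compat_l (|[y]|) _ _ (hnorm_pos y) (HA x)); lra.
Qed.

(** * Fourier expansions and Gram-Schmidt *)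

Definition orthonormal (e : nat -> H) : Prop :=
  forall n k, <|e n, e k|> = RtoC (if Nat.eqb n k then 1 else 0).

Definition total (D : H -> Prop) : Prop :=
  forall x, (forall r, D r -> <|x, r|> = RtoC 0) -> x = hzero H.

Definition total_seq (e : nat -> H) : Prop :=
  forall x, (forall n, <|x, e n|> = RtoC 0) -> x = hzero H.

Definition onb (e : nat -> H) : Prop := orthonormal e /\ total_seq e.

Lemma total_seq_ext e x y : total_seq e -> (forall n, <|x, e n|> = <|y, e n|>) -> x = y.
Proof.
  intros He Hxy; apply hsub_eq_zero, He; intros n.
  rewrite hinner_sub_l, Hxy; ring.
Qed.

Lemma orthonormal_self e n : orthonormal e -> <|e n, e n|> = RtoC 1.
Proof. intros He; rewrite He, Nat.eqb_refl; auto. Qed.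

Lemma orthonormal_neq e n k : orthonormal e -> n <> k -> <|e n, e k|> = RtoC 0.
Proof. intros He Hnk; rewrite He, (proj2 (Nat.eqb_neq n k)); auto. Qed.

Lemma orthonormal_norm e n : orthonormal e -> |[e n]| = 1.
Proof.
  intros He; unfold hnorm; rewrite orthonormal_self by auto; simpl; apply sqrt_1.
Qed.

Lemma pythagoras (w e : H) c : <|w, e|> = RtoC 0 -> <|e, e|> = RtoC 1 ->
  |[w [+] c [*] e]| ^ 2 = |[w]| ^ 2 + Cmod c ^ 2.
Proof.
  intros Hw He; apply RtoC_inj.
  rewrite RtoC_plus, Cmod2_conj, <- !hinner_self; repeat progress inner_simpl.
  rewrite He, Hw, (hinner_conj H w e), Hw, Cconj_RtoC; ring.
Qed.

Definition comb (c : nat -> C) (e : nat -> H) (N : nat) : H := hpsum H (fun k => c k [*] e k) N.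

Lemma comb_orthogonal c e N y :
  (forall k, (k < N)%nat -> <|e k, y|> = RtoC 0) -> <|comb c e N, y|> = RtoC 0.
Proof.
  unfold comb; induction N; intros Hy; simpl; inner_simpl; auto.
  rewrite IHN, Hy by auto; ring.
Qed.

(** Orthonormality is asked only of the indices below [N]: in Gram-Schmidt nothing is known yet
    about later terms. *)
Lemma comb_inner_lt c e N k :
  (forall j, (j < N)%nat -> <|e j, e k|> = RtoC (if Nat.eqb j k then 1 else 0)) ->
  (k < N)%nat -> <|comb c e N, e k|> = c k.
Proof.
  intros He Hk; unfold comb; induction N; [lia |]; simpl; inner_simpl.
  rewrite (He N) by lia; destruct (Nat.eqb_spec N k) as [-> | HNk].
  - fold (comb c e k); rewrite comb_orthogonal; [ring |].
    intros j Hj; rewrite He, (proj2 (Nat.eqb_neq j k)) by lia; auto.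
  - rewrite IHN by (auto; lia); ring.
Qed.

Lemma comb_inner_ge c e N k : orthonormal e -> (N <= k)%nat -> <|comb c e N, e k|> = RtoC 0.
Proof. intros He HN; apply comb_orthogonal; intros; apply orthonormal_neq; auto; lia. Qed.

Lemma comb_dist c e n m : orthonormal e -> (n <= m)%nat ->
  |[comb c e m [-] comb c e n]| ^ 2 =
    rsum (fun k => Cmod (c k) ^ 2) m - rsum (fun k => Cmod (c k) ^ 2) n.
Proof.
  intros He; induction 1 as [| m Hm IH].
  - replace (comb c e n [-] comb c e n) with (hzero H) by hilb; rewrite hnorm_zero; ring.
  - replace (comb c e (S m) [-] comb c e n)
      with ((comb c e m [-] comb c e n) [+] c m [*] e m) by (unfold comb; simpl; hilb).
    rewrite pythagoras, IH; simpl; [ring | | apply orthonormal_self; auto].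
    rewrite hinner_sub_l, !comb_inner_ge by (auto; lia); ring.
Qed.

Lemma comb_norm c e N : orthonormal e ->
  |[comb c e N]| ^ 2 = rsum (fun k => Cmod (c k) ^ 2) N.
Proof.
  intros He; pose proof (comb_dist c e 0 N He (Nat.le_0_l N)) as Hd.
  replace (comb c e N [-] comb c e 0) with (comb c e N) in Hd by (unfold comb; simpl; hilb).
  rewrite Hd; simpl; ring.
Qed.

Lemma comb_limit_coef c e x k : orthonormal e -> hlim (comb c e) x -> <|x, e k|> = c k.
Proof.
  (* From index [S k] on, the coefficient of the partial sums along [e k] is constant. *)
  intros He Hx; apply (clim_unique (fun n => <|comb c e (n + S k)%nat, e k|>)).
  - apply (is_lim_seq_incr_n (fun n => Cmod (Cminus <|comb c e n, e k|> <|x, e k|>)) (S k)).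
    apply (hlim_inner _ _ _ Hx).
  - apply (clim_ext (fun _ => c k)); [| apply clim_const].
    intros n; rewrite comb_inner_lt; auto; lia.
Qed.

(** By [comb_dist], the partial sums form a Cauchy sequence because the bounded increasing sums of
    squares do. *)
Lemma riesz_fischer c e M : complete H -> orthonormal e ->
  (forall N, rsum (fun k => Cmod (c k) ^ 2) N <= M) ->
  exists x, hlim (comb c e) x /\ forall k, <|x, e k|> = c k.
Proof.
  intros Hc He HM.
  assert (Hp : forall k, 0 <= Cmod (c k) ^ 2) by (intros; apply pow2_ge_0).
  destruct (Hc (comb c e)) as [x Hx].
  - intros eps Heps.
    destruct (rsum_cauchy _ M Hp HM (eps ^ 2)) as [N HN]; [apply pow_lt; auto |].
    assert (Hw : forall m n, (N <= n)%nat -> (n <= m)%nat -> |[comb c e m [-] comb c e n]| < eps).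
    { intros m n Hn Hm; specialize (HN m n ltac:(lia) Hn); rewrite <- (comb_dist c e) in HN by auto.
      rewrite Rabs_pos_eq in HN by apply pow2_ge_0.
      apply Rsqr_incrst_0; [rewrite !Rsqr_pow2; auto | apply hnorm_pos | lra]. }
    exists N; intros m n Hm Hn; destruct (Nat.le_ge_cases n m); auto.
    rewrite hnorm_sub_sym; auto.
  - exists x; split; [exact Hx |]; intros k; apply comb_limit_coef; auto.
Qed.

Lemma bessel e x N : orthonormal e -> rsum (fun k => Cmod <|x, e k|> ^ 2) N <= |[x]| ^ 2.
Proof.
  intros He.
  (* An exact Pythagorean decomposition is stronger than the inequality and can be proved by
     induction. *)
  assert (Hb : forall n, |[x]| ^ 2 =
    |[x [-] comb (fun k => <|x, e k|>) e n]| ^ 2 + rsum (fun k => Cmod <|x, e k|> ^ 2) n).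
  { induction n as [| n IH].
    - replace (x [-] comb (fun k => <|x, e k|>) e 0) with x by (unfold comb; simpl; hilb).
      simpl; ring.
    - rewrite IH; set (w := x [-] comb (fun k => <|x, e k|>) e (S n)).
      replace (x [-] comb (fun k => <|x, e k|>) e n) with (w [+] <|x, e n|> [*] e n)
        by (unfold w, comb; simpl; hilb).
      rewrite pythagoras; simpl; [ring | | apply orthonormal_self; auto].
      unfold w; rewrite hinner_sub_l, comb_inner_lt by (auto; lia); ring. }
  rewrite (Hb N); pose proof (pow2_ge_0 (|[x [-] comb (fun k => <|x, e k|>) e N]|)); lra.
Qed.

(** Bessel and Riesz-Fischer give a convergent expansion with the coefficients of [x]; totality
    identifies its sum with [x]. *)
Lemma onb_expansion e x : complete H -> onb e -> hlim (comb (fun k => <|x, e k|>) e) x.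
Proof.
  intros Hc [He Ht].
  destruct (riesz_fischer (fun k => <|x, e k|>) e (|[x]| ^ 2) Hc He) as [z [Hz Hk]].
  - intros N; apply bessel; auto.
  - rewrite (total_seq_ext e z x) in Hz; auto.
Qed.

Lemma comb_linear T c e N : linear_map T -> T (comb c e N) = comb c (fun k => T (e k)) N.
Proof.
  intros HT; unfold comb; rewrite linear_map_hpsum by auto.
  apply hpsum_ext; intros; apply (proj2 HT).
Qed.

(** The image of [y] is built from the coefficients [<|y, P (e k)|>] that it must have. They are
    square summable because the squared norm of a partial sum [s] equals [Re <|y, P s|>], at most
    [|[y]| * M * |[s]|]. *)
Lemma adjoint_exists e P M : complete H -> onb e -> linear_map P ->
  (forall x, |[P x]| <= M * |[x]|) -> exists S, adjoint P S.
Proof.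
  intros Hc He HP HM.
  assert (Hy : forall y, exists z, forall x, <|P x, y|> = <|x, z|>).
  { intros y; set (c := fun k => <|y, P (e k)|>).
    assert (Hz : forall N, |[comb c e N]| ^ 2 = Re <|y, P (comb c e N)|>).
    { intros N; rewrite comb_norm by apply He; rewrite comb_linear by auto.
      unfold comb; induction N; cbn [rsum hpsum]; inner_simpl; [reflexivity |].
      rewrite re_plus, <- IHN, Cmod_sqr_re, Cmult_comm; reflexivity. }
    destruct (riesz_fischer c e ((|[y]| * M) ^ 2) Hc (proj1 He)) as [z [Hl Hk]].
    - intros N; rewrite <- (comb_norm c e) by apply He.
      assert (Hle : |[comb c e N]| ^ 2 <= (|[y]| * M) * |[comb c e N]|).
      { rewrite Hz at 1; eapply Rle_trans; [apply Rle_abs |].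
        eapply Rle_trans; [apply re_le_Cmod |].
        eapply Rle_trans; [apply cauchy_schwarz |].
        rewrite Rmult_assoc; apply Rmult_le_compat_l; [apply hnorm_pos | apply HM]. }
      pose proof (hnorm_pos (comb c e N)).
      destruct (hnorm_le_of_sqr _ _ Hle) as [Hb | ->]; [apply pow_incr; lra |].
      pose proof (pow2_ge_0 (|[y]| * M)); lra.
    - exists z; intros x.
      (* The adjoint identity holds for the partial sums of the expansion of [x] and passes to the
         limit. *)
      apply (clim_unique (fun n => <|P (comb (fun k => <|x, e k|>) e n), y|>)).
      + apply hlim_inner, (hlim_linear _ M); auto; apply onb_expansion; auto.
      + apply (clim_ext (fun n => <|comb (fun k => <|x, e k|>) e n, z|>)).
        * intros n; rewrite comb_linear by auto; unfold comb; rewrite !hinner_hpsum_l.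
          apply csum_ext; intros k; inner_simpl.
          rewrite (hinner_conj H z (e k)), Hk; unfold c.
          rewrite <- hinner_conj; auto.
        * apply hlim_inner, onb_expansion; auto. }
  exists (fun y => proj1_sig (constructive_indefinite_description _ (Hy y))).
  intros x y; destruct constructive_indefinite_description as [z Hz]; simpl; auto.
Qed.

(** Gram-Schmidt on a dense sequence [d]. The last condition on [v] puts [d n] in the span of the
    first [n + 1] basis vectors, so a vector orthogonal to the basis is orthogonal to every
    [d n]. *)
Lemma onb_exists : separable H -> infinite_dimensional H -> exists e : nat -> H, onb e.
Proof.
  intros [d Hd] Hinf.
  destruct (course_of_values_choice H (hzero H) (fun n p v =>
    <|v, v|> = RtoC 1 /\ (forall k, (k < n)%nat -> <|v, p k|> = RtoC 0) /\
    d n [-] comb (fun k => <|d n, p k|>) p n = <|d n, v|> [*] v)) as [e He].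
  - intros n p q v Hpq [H1 [H2 H3]]; split; auto; split.
    + intros k Hk; rewrite <- Hpq; auto.
    + rewrite <- H3; f_equal; apply hpsum_ext; intros k Hk; rewrite Hpq; auto.
  - intros n p Hp.
    assert (Hon : forall j k, (j < n)%nat -> (k < n)%nat ->
      <|p j, p k|> = RtoC (if Nat.eqb j k then 1 else 0)).
    { intros j k Hj Hk; destruct (Nat.eqb_spec j k) as [-> | Hjk]; [apply Hp; auto |].
      destruct (proj1 (Nat.lt_gt_cases j k) Hjk).
      - rewrite hinner_conj, (proj1 (proj2 (Hp k Hk))), Cconj_RtoC; auto.
      - apply (proj1 (proj2 (Hp j Hj))); auto. }
    set (resid := fun x => x [-] comb (fun k => <|x, p k|>) p n).
    assert (Hr : forall x k, (k < n)%nat -> <|resid x, p k|> = RtoC 0).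
    { intros x k Hk; unfold resid; rewrite hinner_sub_l, comb_inner_lt; auto; ring. }
    assert (Hunit : forall w, w <> hzero H -> (forall k, (k < n)%nat -> <|w, p k|> = RtoC 0) ->
      exists v, v = RtoC (/ |[w]|) [*] w /\ <|v, v|> = RtoC 1 /\
        forall k, (k < n)%nat -> <|v, p k|> = RtoC 0).
    { intros w Hw Hwp; exists (RtoC (/ |[w]|) [*] w); split; auto; split.
      - inner_simpl; rewrite Cconj_RtoC, hinner_self, <- !RtoC_mult; f_equal.
        field; intros H0; apply Hw, hnorm_eq_zero; auto.
      - intros k Hk; rewrite hinner_scal_l, Hwp by auto; ring. }
    destruct (classic (resid (d n) = hzero H)) as [H0 | H0].
    (* Here [d n] already lies in the span of the earlier vectors. To keep the sequence going, the
       new vector is taken from some [x] outside that span; [d n] is orthogonal to it, so the last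
       condition reads [0 = 0]. *)
    + destruct (Hinf n p) as [x Hx].
      destruct (Hunit (resid x)) as [v [_ [Hv Hvp]]]; auto.
      { intros Hx0; apply (Hx (fun k => <|x, p k|>)), hsub_eq_zero; auto. }
      exists v; split; auto; split; auto; fold (resid (d n)); rewrite H0.
      replace <|d n, v|> with (RtoC 0); [hilb |].
      rewrite (hsub_eq_zero _ _ H0), comb_orthogonal; auto.
      intros k Hk; rewrite hinner_conj, Hvp, Cconj_RtoC; auto.
    + destruct (Hunit (resid (d n))) as [v [Ev [Hv Hvp]]]; auto.
      exists v; split; auto; split; auto; fold (resid (d n)).
      assert (Hdv : <|d n, v|> = <|resid (d n), v|>).
      { unfold resid; rewrite hinner_sub_l, (comb_orthogonal _ _ _ v); [ring |].
        intros k Hk; rewrite hinner_conj, Hvp, Cconj_RtoC; auto. }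
      assert (Hn : |[resid (d n)]| <> 0) by (intros Hz; apply H0, hnorm_eq_zero; auto).
      rewrite Hdv, Ev, hinner_scal_r, hinner_self, Cconj_RtoC, hscal_assoc, <- !RtoC_mult.
      transitivity (RtoC 1 [*] resid (d n)); [rewrite hscal_one; auto |].
      f_equal; f_equal; field; auto.
  - exists e; split.
    + intros n k; destruct (Nat.eqb_spec n k) as [-> | Hnk]; [apply He |].
      destruct (proj1 (Nat.lt_gt_cases n k) Hnk).
      * rewrite hinner_conj, (proj1 (proj2 (He k))), Cconj_RtoC; auto.
      * apply (proj1 (proj2 (He n))); auto.
    + intros x Hx; apply hnorm_eq_zero.
      assert (Hex : forall k, <|e k, x|> = RtoC 0).
      { intros k; rewrite hinner_conj, Hx, Cconj_RtoC; auto. }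
      assert (Hdx : forall n, <|d n, x|> = RtoC 0).
      { intros n; transitivity <|d n [-] comb (fun k => <|d n, e k|>) e n, x|>.
        - rewrite hinner_sub_l, (comb_orthogonal _ _ _ x) by auto; ring.
        - rewrite (proj2 (proj2 (He n))), hinner_scal_l, Hex; ring. }
      destruct (Rle_lt_or_eq_dec _ _ (hnorm_pos x)) as [Hp |]; auto; exfalso.
      destruct (Hd x (|[x]|) Hp) as [n Hn].
      (* Orthogonality keeps every [d n] at distance at least [|[x]|] from [x], against density. *)
      assert (Hs : |[x [-] d n]| ^ 2 = |[x]| ^ 2 + |[d n]| ^ 2).
      { rewrite !hnorm_sqr; repeat progress inner_simpl.
        rewrite (hinner_conj H (d n) x), Hdx, Cconj_RtoC, <- re_plus; f_equal; ring. }
      pose proof (hnorm_pos (x [-] d n)); pose proof (pow2_ge_0 (|[d n]|)); nra.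
Qed.

(** * Uniform boundedness and closed graph *)

Lemma parallelogram (x y : H) :
  |[x [-] y]| ^ 2 = 2 * |[x]| ^ 2 + 2 * |[y]| ^ 2 - |[x [+] y]| ^ 2.
Proof.
  rewrite !hnorm_sqr; repeat progress inner_simpl.
  unfold Cminus; rewrite !re_plus, !re_opp, !re_plus, !re_opp; ring.
Qed.

(* Sokal's gliding hump: step [n] moves by [3^-n] in the direction [+-x n], whichever makes
   the pairing with [x n] large; the later steps cannot undo this. *)
Lemma uniform_boundedness (S : H -> Prop) : complete H ->
  (forall y, exists M, forall x, S x -> Cmod <|x, y|> <= M) ->
  exists M, forall x, S x -> |[x]| <= M.
Proof.
  intros Hc Hpt; apply NNPP; intros Hn.
  (* The factor [3 ^ n] offsets the step length, so that [(/ 3) ^ n * |[x n]|] still exceeds [n]. *)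
  assert (Hbig : forall n, exists x, S x /\ INR n * 3 ^ n < |[x]|).
  { intros n; apply NNPP; intros Hx; apply Hn; exists (INR n * 3 ^ n); intros x HS.
    apply Rnot_lt_le; intros Hlt; apply Hx; eauto. }
  set (x := fun n => proj1_sig (constructive_indefinite_description _ (Hbig n))).
  assert (Hx : forall n, S (x n) /\ INR n * 3 ^ n < |[x n]|).
  { intros n; unfold x; destruct constructive_indefinite_description; auto. }
  assert (Hxp : forall n, 0 < |[x n]|).
  { intros n; eapply Rle_lt_trans; [| apply Hx].
    apply Rmult_le_pos; [apply pos_INR | apply pow_le; lra]. }
  assert (Hq : forall n, 0 < (/ 3) ^ n) by (intros; apply pow_lt; lra).
  assert (Hstep : forall n y, exists y', |[y' [-] y]| <= (/ 3) ^ n /\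
    (/ 3) ^ n * |[x n]| <= Cmod <|x n, y'|>).
  { intros n y; set (h := RtoC ((/ 3) ^ n / |[x n]|) [*] x n).
    assert (Hh : |[h]| = (/ 3) ^ n).
    { unfold h; rewrite hnorm_scal, Cmod_R, Rabs_pos_eq.
      - field; apply Rgt_not_eq, Hxp.
      - apply Rlt_le, Rdiv_lt_0_compat; auto. }
    assert (Hxh : Cmod <|x n, h|> = (/ 3) ^ n * |[x n]|).
    { unfold h; rewrite hinner_scal_r, hinner_self, Cconj_RtoC, <- RtoC_mult, Cmod_R.
      rewrite Rabs_pos_eq; [field; apply Rgt_not_eq, Hxp |].
      apply Rmult_le_pos; [apply Rlt_le, Rdiv_lt_0_compat; auto | apply pow2_ge_0]. }
    (* The pairings with [y + h] and [y - h] differ by [2 <|x n, h|>], so one of them has modulus at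
       least that of [<|x n, h|>]. *)
    destruct (Rle_dec (Cmod <|x n, h|>) (Cmod <|x n, y [+] h|>)) as [Hle | Hle].
    - exists (y [+] h); split; [| lra].
      replace (y [+] h [-] y) with h by hilb; lra.
    - exists (y [-] h); split.
      + replace (y [-] h [-] y) with (Copp (RtoC 1) [*] h) by hilb.
        rewrite hnorm_scal, Cmod_opp, Cmod_1; lra.
      + rewrite <- Hxh.
        pose proof (Cmod_triangle <|x n, y [+] h|> (Copp <|x n, y [-] h|>)) as Ht.
        rewrite Cmod_opp in Ht.
        replace (Cplus <|x n, y [+] h|> (Copp <|x n, y [-] h|>))
          with (Cmult (RtoC 2) <|x n, h|>) in Ht by (inner_simpl; ring).
        rewrite Cmod_mult, Cmod_R, Rabs_pos_eq in Ht by lra; lra. }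
  set (next := fun n y => proj1_sig (constructive_indefinite_description _ (Hstep n y))).
  assert (Hnext : forall n y, |[next n y [-] y]| <= (/ 3) ^ n /\
    (/ 3) ^ n * |[x n]| <= Cmod <|x n, next n y|>).
  { intros n y; unfold next; destruct constructive_indefinite_description; auto. }
  set (u := fix u n := match n with O => hzero H | Datatypes.S m => next m (u m) end).
  destruct (geometric_limit u 1 (/ 3)) as [l [_ Hl]]; auto; try lra.
  { intros n; rewrite Rmult_1_l; apply Hnext. }
  destruct (Hpt l) as [M HM].
  destruct (INR_unbounded (2 * M)) as [n HnM].
  specialize (HM (x n) (proj1 (Hx n))); specialize (Hl (Datatypes.S n)); simpl in Hl.
  destruct (Hnext n (u n)) as [_ Hun]; specialize (Hxp n); specialize (Hq n).
  assert (Hxn : INR n < (/ 3) ^ n * |[x n]|).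
  { apply (Rmult_lt_reg_l (3 ^ n)); [apply pow_lt; lra |].
    rewrite <- Rmult_assoc, <- Rpow_mult_distr, Rinv_r, pow1 by lra.
    pose proof (proj2 (Hx n)); lra. }
  pose proof (cauchy_schwarz (x n) (l [-] next n (u n))) as Hcs.
  (* The moves after step [n] add up to at most half of [(/ 3) ^ n]. Hence half of the pairing
     survives in the limit, which is more than [n / 2], hence more than [M]. *)
  assert (Hd : |[x n]| * |[l [-] next n (u n)]| <= |[x n]| * (/ 2 * (/ 3) ^ n)).
  { apply Rmult_le_compat_l; lra. }
  pose proof (Cmod_triangle <|x n, l|> (Copp <|x n, l [-] next n (u n)|>)) as Ht.
  rewrite Cmod_opp in Ht.
  replace (Cplus <|x n, l|> (Copp <|x n, l [-] next n (u n)|>))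
    with <|x n, next n (u n)|> in Ht by (inner_simpl; ring).
  lra.
Qed.

(** Projection onto the closure of [D] without forming the closure: approximate minimisers of the
    distance to [y] converge to some [z], and [y - z] is orthogonal to [D], hence zero. *)
Lemma total_subspace_dense (D : H -> Prop) : complete H ->
  D (hzero H) -> (forall x y, D x -> D y -> D (x [+] y)) -> (forall a x, D x -> D (a [*] x)) ->
  total D -> forall y eps, 0 < eps -> exists r, D r /\ |[y [-] r]| < eps.
Proof.
  intros Hc D0 Dadd Dscal Ht y.
  (* The infimum [d] of the squared distances, as minus a supremum. *)
  destruct (completeness (fun m => exists r, D r /\ m = - |[y [-] r]| ^ 2)) as [m [Hub Hlub]].
  { exists 0; intros m [r [_ ->]]; pose proof (pow2_ge_0 (|[y [-] r]|)); lra. }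
  { eexists; eexists; eauto. }
  set (d := - m).
  assert (Hd : forall r, D r -> d <= |[y [-] r]| ^ 2).
  { intros r Hr; assert (- |[y [-] r]| ^ 2 <= m) by (apply Hub; eauto); unfold d; lra. }
  assert (Hinv : forall n, 0 < / INR (S n)).
  { intros n; apply Rinv_0_lt_compat, lt_0_INR; lia. }
  assert (Hex : forall n, exists r, D r /\ |[y [-] r]| ^ 2 < d + / INR (S n)).
  { intros n; apply NNPP; intros Hn; specialize (Hinv n).
    assert (m <= m - / INR (S n)); [| lra].
    apply Hlub; intros m' [r [Hr ->]].
    apply Rnot_lt_le; intros Hlt; apply Hn; exists r; split; auto; unfold d; lra. }
  set (r := fun n => proj1_sig (constructive_indefinite_description _ (Hex n))).
  assert (Hr : forall n, D (r n) /\ |[y [-] r n]| ^ 2 < d + / INR (S n)).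
  { intros n; unfold r; destruct constructive_indefinite_description; auto. }
  assert (Hsmall : forall eps, 0 < eps -> exists N, forall n, (N <= n)%nat -> / INR (S n) < eps).
  { intros eps Heps; destruct (INR_unbounded (/ eps)) as [N HN]; exists N; intros n Hn.
    assert (INR N <= INR (S n)) by (apply le_INR; lia).
    assert (0 < / eps) by (apply Rinv_0_lt_compat; auto).
    rewrite <- (Rinv_inv eps); apply Rinv_lt_contravar; [apply Rmult_lt_0_compat |]; lra. }
  destruct (Hc r) as [z Hz].
  { intros eps Heps; destruct (Hsmall (eps ^ 2 / 4)) as [N HN].
    { assert (0 < eps ^ 2) by (apply pow_lt; auto); lra. }
    exists N; intros i j Hi Hj.
    (* The midpoint of [r i] and [r j] lies in [D]. With the parallelogram law this bounds the
       squared distance of [r i] and [r j] by [2 / (i + 1) + 2 / (j + 1)]. *)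
    assert (Hmid : 4 * d <= |[(y [-] r i) [+] (y [-] r j)]| ^ 2).
    { replace ((y [-] r i) [+] (y [-] r j))
        with (RtoC 2 [*] (y [-] RtoC (/ 2) [*] (r i [+] r j))).
      - rewrite hnorm_scal, Cmod_R, Rabs_pos_eq by lra.
        pose proof (Hd _ (Dscal (RtoC (/ 2)) _ (Dadd _ _ (proj1 (Hr i)) (proj1 (Hr j))))).
        rewrite Rpow_mult_distr; lra.
      - hilb; rewrite RtoC_inv by lra; field; intros E0; injection E0; lra. }
    replace (r i [-] r j) with ((y [-] r j) [-] (y [-] r i)) by hilb.
    apply Rsqr_incrst_0; [| apply hnorm_pos | lra].
    rewrite !Rsqr_pow2, parallelogram.
    replace ((y [-] r j) [+] (y [-] r i)) with ((y [-] r i) [+] (y [-] r j)) by hilb.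
    pose proof (proj2 (Hr i)); pose proof (proj2 (Hr j)).
    pose proof (HN i Hi); pose proof (HN j Hj); lra. }
  assert (Hyz : y [-] z = hzero H).
  { apply Ht; intros s Hs.
    apply (clim_unique (fun n => <|y [-] r n, s|>)).
    { apply (hlim_inner (fun n => y [-] r n)).
      eapply hlim_le; [| exact Hz]; intros n; simpl.
      replace (y [-] r n [-] (y [-] z)) with (z [-] r n) by hilb.
      rewrite hnorm_sub_sym; lra. }
    set (q := fun n => <|y [-] r n, s|>).
    assert (Hs2 : 0 <= |[s]| ^ 2) by apply pow2_ge_0.
    (* Moving [r n] within [D] by [t (q n) s] cannot bring the squared distance below [d]. The
       choice of [t] gives [t * |[s]| ^ 2 <= 1] and also covers [s = 0]. *)
    assert (Hq : forall n, Cmod (q n) ^ 2 <= (|[s]| ^ 2 + 1) * / INR (S n)).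
    { intros n; set (t := / (|[s]| ^ 2 + 1)).
      assert (Htt : t * (|[s]| ^ 2 + 1) = 1) by (unfold t; field; lra).
      assert (Htp : 0 < t) by (apply Rinv_0_lt_compat; lra).
      assert (Hexp : |[y [-] (r n [+] Cmult (RtoC t) (q n) [*] s)]| ^ 2 =
        |[y [-] r n]| ^ 2 - 2 * t * Cmod (q n) ^ 2 + t ^ 2 * Cmod (q n) ^ 2 * |[s]| ^ 2).
      { apply RtoC_inj; rewrite <- hinner_self.
        rewrite !RtoC_plus, RtoC_minus, !RtoC_mult, (RtoC_pow t), !Cmod2_conj, <- !hinner_self.
        replace (y [-] (r n [+] Cmult (RtoC t) (q n) [*] s))
          with ((y [-] r n) [-] Cmult (RtoC t) (q n) [*] s) by hilb.
        rewrite (hinner_sub_l (y [-] r n)), !(hinner_sub_r (y [-] r n)).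
        rewrite !hinner_scal_r, !hinner_scal_l, (hinner_conj H (y [-] r n) s); fold (q n).
        rewrite Cmult_conj, Cconj_RtoC; ring. }
      pose proof (Hd _ (Dadd _ _ (proj1 (Hr n)) (Dscal (Cmult (RtoC t) (q n)) _ Hs))) as Hdn.
      rewrite Hexp in Hdn; pose proof (proj2 (Hr n)) as Hrn.
      assert (Hqn : 0 <= Cmod (q n) ^ 2) by apply pow2_ge_0.
      assert (Htq : t * Cmod (q n) ^ 2 <= / INR (S n)) by nra.
      apply (Rmult_le_reg_l t); auto.
      rewrite <- Rmult_assoc, Htt; lra. }
    apply is_lim_seq_spec; intros [eps Heps]; simpl.
    destruct (Hsmall (eps ^ 2 / (|[s]| ^ 2 + 1))) as [N HN].
    { apply Rdiv_lt_0_compat; [apply pow_lt; auto | lra]. }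
    exists N; intros n Hn; specialize (HN n Hn); specialize (Hq n).
    replace (Cminus (q n) (RtoC 0)) with (q n) by ring.
    rewrite Rminus_0_r, Rabs_pos_eq by apply Cmod_ge_0.
    apply Rsqr_incrst_0; [| apply Cmod_ge_0 | lra]; rewrite !Rsqr_pow2.
    eapply Rle_lt_trans; [exact Hq |].
    apply (Rmult_lt_compat_l (|[s]| ^ 2 + 1)) in HN; [| lra].
    replace ((|[s]| ^ 2 + 1) * (eps ^ 2 / (|[s]| ^ 2 + 1))) with (eps ^ 2) in HN by (field; lra).
    exact HN. }
  intros eps Heps; destruct (hlim_eps r z Hz eps Heps) as [N HN].
  exists (r N); split; [apply Hr |].
  rewrite (hsub_eq_zero _ _ Hyz), hnorm_sub_sym; apply HN; auto.
Qed.

(* The closed graph theorem, with the closed graph expressed by a densely defined adjoint. *)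
Lemma total_adjoint_bounded (T : H -> H) : complete H ->
  total (fun r => exists w, forall x, <|T x, r|> = <|x, w|>) ->
  linear_map T /\ exists M, 0 <= M /\ forall x, |[T x]| <= M * |[x]|.
Proof.
  intros Hc; set (D := fun r => exists w, forall x, <|T x, r|> = <|x, w|>); intros Ht.
  split.
  { split; intros; apply hsub_eq_zero, Ht; intros r [w Hw];
      repeat progress inner_simpl; rewrite !Hw; inner_simpl; ring. }
  (* The adjoint images [w] of the unit ball of the domain are pointwise bounded: the pairing of [w]
     with [y] has modulus at most [|[T y]|]. *)
  destruct (uniform_boundedness
    (fun w => exists r, |[r]| <= 1 /\ forall x, <|T x, r|> = <|x, w|>)) as [M HM]; auto.
  { intros y; exists (|[T y]|); intros w [r [Hr Hw]].
    rewrite hinner_conj, Cmod_conj, <- Hw.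
    eapply Rle_trans; [apply cauchy_schwarz |].
    pose proof (hnorm_pos (T y)); nra. }
  assert (HMr : forall r w, (forall x, <|T x, r|> = <|x, w|>) -> |[w]| <= M * |[r]|).
  { intros r w Hw; destruct (Req_dec (|[r]|) 0) as [Hr | Hr].
    - rewrite Hr, Rmult_0_r; apply hnorm_le_pairing; [lra |]; intros y.
      rewrite hinner_conj, Cmod_conj, <- Hw, (hnorm_eq_zero _ Hr), hinner_zero_r, Cmod_0; lra.
    - assert (Hrp : 0 < |[r]|) by (pose proof (hnorm_pos r); lra).
      assert (Hi : 0 <= / |[r]|) by (apply Rlt_le, Rinv_0_lt_compat; auto).
      assert (Hle : |[RtoC (/ |[r]|) [*] w]| <= M).
      { apply HM; exists (RtoC (/ |[r]|) [*] r); split.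
        - rewrite hnorm_scal, Cmod_R, Rabs_pos_eq, Rinv_l by auto; lra.
        - intros x; rewrite !hinner_scal_r, Hw; auto. }
      rewrite hnorm_scal, Cmod_R, Rabs_pos_eq in Hle by auto.
      apply (Rmult_le_compat_r (|[r]|)) in Hle; [| lra].
      replace (/ |[r]| * |[w]| * |[r]|) with (|[w]|) in Hle by (field; auto); auto. }
  assert (HM0 : 0 <= M).
  { eapply Rle_trans; [apply (hnorm_pos (hzero H)) |].
    apply HM; exists (hzero H); split; [rewrite hnorm_zero; lra |].
    intros x; rewrite !hinner_zero_r; auto. }
  exists M; split; auto; intros x.
  assert (Hdense : forall eps, 0 < eps -> exists r, D r /\ |[T x [-] r]| < eps).
  { apply total_subspace_dense; auto.
    - exists (hzero H); intros; rewrite !hinner_zero_r; auto.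
    - intros r1 r2 [w1 H1] [w2 H2]; exists (w1 [+] w2); intros; inner_simpl; rewrite H1, H2; auto.
    - intros a r [w Hw]; exists (a [*] w); intros; inner_simpl; rewrite Hw; auto. }
  apply Rnot_lt_le; intros Hlt.
  (* If the excess [g] were positive, an [r] in [D] within [g / 2] of [T x] would have norm at most
     [M * |[x]| + g / 2], making [|[T x]|] smaller than itself. *)
  set (g := |[T x]| - M * |[x]|).
  destruct (Hdense (g / 2)) as [r [[w Hw] Hr]]; [unfold g; lra |].
  assert (Hxr : Cmod <|T x, r|> <= M * |[x]| * |[r]|).
  { rewrite Hw; eapply Rle_trans; [apply cauchy_schwarz |].
    pose proof (Rmult_le_compat_l (|[x]|) _ _ (hnorm_pos x) (HMr r w Hw)); lra. }
  assert (Hrr : |[r]| ^ 2 <= (M * |[x]| + g / 2) * |[r]|).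
  { replace (|[r]| ^ 2) with (Cmod <|r, r|>).
    2: { rewrite hinner_self, Cmod_R, Rabs_pos_eq; auto; apply pow2_ge_0. }
    replace <|r, r|> with (Cplus <|T x, r|> (Copp <|T x [-] r, r|>)) by (inner_simpl; ring).
    eapply Rle_trans; [apply Cmod_triangle |]; rewrite Cmod_opp.
    pose proof (cauchy_schwarz (T x [-] r) r).
    pose proof (Rmult_le_compat_r (|[r]|) _ _ (hnorm_pos r) (Rlt_le _ _ Hr)); lra. }
  pose proof (hnorm_le_sub (T x) r) as Htr.
  assert (0 <= M * |[x]|) by (apply Rmult_le_pos; auto; apply hnorm_pos).
  destruct (hnorm_le_of_sqr _ _ Hrr) as [Hb | Hb]; unfold g in *; lra.
Qed.

(** Serves for maps obtained by pointwise choice, of which only the pairings with a total sequence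
    are known. *)
Lemma total_image_bounded (T : H -> H) (u v : nat -> H) : complete H -> total_seq u ->
  (forall x n, <|T x, u n|> = <|x, v n|>) ->
  linear_map T /\ exists M, 0 <= M /\ forall x, |[T x]| <= M * |[x]|.
Proof.
  intros Hc Hu HT; apply total_adjoint_bounded; auto.
  intros x Hx; apply Hu; intros n; apply Hx; exists (v n); auto.
Qed.

(** * Matrix preimages of orthonormal bases *)

Lemma mat_apply_unique E (F G1 G2 : nat -> H) :
  mat_apply H E F G1 -> mat_apply H E F G2 -> forall n, G1 n = G2 n.
Proof.
  intros H1 H2 n; apply (hlim_unique (hpsum H (fun k => E n k [*] F k)));
    apply has_sum_hlim; auto.
Qed.

Lemma hlim_scal_l z w (h : H) : clim z w -> hlim (fun n => z n [*] h) (w [*] h).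
Proof.
  intros Hz; eapply hlim_le; [| exact (is_lim_seq_0_scal _ (|[h]|) Hz)]; intros n; simpl.
  replace (z n [*] h [-] w [*] h) with (Cminus (z n) w [*] h) by hilb.
  rewrite hnorm_scal; lra.
Qed.

Lemma onb_E_orthonormal_basis E (g e : nat -> H) : complete H -> onb e ->
  mat_apply H E g e -> E_orthonormal_basis H E g.
Proof.
  intros Hc He Hg; split.
  - exists e; split; auto; intros x; split.
    + exists (fun k => <|x, e k|>); apply has_sum_hlim, onb_expansion; auto.
    + intros c d Hx1 Hx2 k; apply has_sum_hlim in Hx1, Hx2.
      rewrite <- (comb_limit_coef c e x), <- (comb_limit_coef d e x); auto; apply He.
  - intros Eg HEg n k.
    rewrite !(mat_apply_unique _ _ _ _ HEg Hg); apply He.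
Qed.

(* With [r n] the vector whose coordinates in [e] form the [n]-th row of [E], injectivity of
   [E] makes [r] total and surjectivity gives [A] with [<r n, A x> = <e n, x>].  Then [A] is
   bounded, its adjoint sends [r n] to [e n], and [g k] is the image of [e k]. *)
Lemma onb_matrix_preimage E (e : nat -> H) : complete H -> onb e ->
  invertible_matrix_mapping H E -> exists g, mat_apply H E g e.
Proof.
  (* Scalar sequences are embedded as multiples of the unit vector [h], which turns the hypotheses
     on [E] into statements about [l^2]. *)
  intros Hc He [Hdef [Hinj Hsurj]]; destruct He as [Ho Ht]; set (h := e 0%nat).
  assert (Hh : <|h, h|> = RtoC 1) by (apply orthonormal_self; auto).
  assert (Hl2 : forall y, in_l2H H (fun k => <|e k, y|> [*] h)).
  { intros y; apply (ex_series_rsum_bounded _ (|[y]| ^ 2)); [intros; apply pow2_ge_0 |].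
    intros N; eapply Rle_trans; [| apply (bessel e y N Ho)]; right.
    apply rsum_ext; intros k; rewrite hnorm_scal, (hinner_conj H y (e k)), Cmod_conj.
    unfold h; rewrite (orthonormal_norm e) by auto; ring. }
  assert (Hpart : forall n N y,
    hpsum H (fun k => E n k [*] (<|e k, y|> [*] h)) N = <|comb (E n) e N, y|> [*] h).
  { intros n N y; unfold comb; rewrite hinner_hpsum_l, <- hpsum_scal.
    apply hpsum_ext; intros k _; hilb. }
  (* Since [E] is defined on all of [l^2], the truncated rows are pointwise bounded as functionals;
     uniform boundedness then makes each row square summable. *)
  assert (Hr : forall n, exists r, hlim (comb (E n) e) r).
  { intros n.
    destruct (uniform_boundedness (fun x => exists N, x = comb (E n) e N)) as [M HM]; auto.
    - intros y; destruct (Hdef _ (Hl2 y)) as [EF [HEF _]].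
      specialize (HEF n); apply has_sum_hlim in HEF.
      apply (hlim_inner _ _ h) in HEF.
      destruct (clim_bounded _ _ HEF) as [M HM]; exists M; intros x [N ->].
      specialize (HM N); rewrite Hpart, hinner_scal_l, Hh, Cmult_1_r in HM; auto.
    - destruct (riesz_fischer (E n) e (M ^ 2) Hc Ho) as [r [Hr _]]; [| exists r; auto].
      intros N; rewrite <- (comb_norm (E n) e) by auto.
      apply pow_incr; split; [apply hnorm_pos | apply HM; eauto]. }
  destruct (ClassicalEpsilon.choice _ Hr) as [r Hrl].
  assert (Hmat : forall y, mat_apply H E (fun k => <|e k, y|> [*] h) (fun n => <|r n, y|> [*] h)).
  { intros y n; apply has_sum_hlim.
    apply (hlim_ext (fun N => <|comb (E n) e N, y|> [*] h)); [intros; rewrite Hpart; auto |].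
    apply hlim_scal_l, hlim_inner, Hrl. }
  assert (Htr : total_seq r).
  { intros x Hx; apply Ht; intros k; rewrite hinner_conj.
    assert (Hk : <|e k, x|> [*] h = <|e k, hzero H|> [*] h).
    { apply (Hinj _ _ (fun n => <|r n, x|> [*] h) (Hl2 x) (Hl2 (hzero H)) (Hmat x)).
      intros n; rewrite hinner_conj, Hx, Cconj_RtoC, <- (hinner_zero_r (r n)); apply Hmat. }
    apply (f_equal (fun z => <|z, h|>)) in Hk.
    rewrite !hinner_scal_l, Hh, !Cmult_1_r, hinner_zero_r in Hk.
    rewrite Hk, Cconj_RtoC; auto. }
  assert (HA : forall x, exists y, forall n, <|y, r n|> = <|x, e n|>).
  { intros x; destruct (Hsurj _ (Hl2 x)) as [F [HF HEF]].
    (* The preimage [F] need not be a multiple of [h]; its components along [h] are enough,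
       conjugated because [y] stands in the second slot of [<|r n, y|>]. *)
    destruct (riesz_fischer (fun k => Cconj <|F k, h|>) e
      (Series (fun k => |[F k]| ^ 2)) Hc Ho) as [y [_ Hy]].
    - intros N.
      apply Rle_trans with (rsum (fun k => |[F k]| ^ 2) N).
      + induction N as [| N IH]; cbn [rsum]; [lra |].
        apply Rplus_le_compat; auto; apply pow_incr; split; [apply Cmod_ge_0 |].
        rewrite Cmod_conj; eapply Rle_trans; [apply cauchy_schwarz |].
        unfold h; rewrite (orthonormal_norm e) by auto; lra.
      + apply rsum_le_Series; auto; intros; apply pow2_ge_0.
    - exists y; intros n; rewrite (hinner_conj H (r n) y), (hinner_conj H (e n) x); f_equal.
      transitivity <|<|e n, x|> [*] h, h|>; [| rewrite hinner_scal_l, Hh; ring].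
      apply (clim_unique (fun N => <|comb (E n) e N, y|>)); [apply hlim_inner, Hrl |].
      apply (clim_ext (fun N => <|hpsum H (fun k => E n k [*] F k) N, h|>)).
      + intros N; unfold comb; rewrite !hinner_hpsum_l; apply csum_ext; intros k.
        rewrite !hinner_scal_l, (hinner_conj H y (e k)), Hy, Cconj_conj; auto.
      + apply hlim_inner, has_sum_hlim, HEF. }
  destruct (ClassicalEpsilon.choice _ HA) as [A HAr].
  destruct (total_image_bounded A r e Hc Htr HAr) as [HAl [M [HM HAM]]].
  destruct (adjoint_exists e A M Hc (conj Ho Ht) HAl HAM) as [S HS].
  exists (fun k => S (e k)); intros n; apply has_sum_hlim.
  pose proof (adjoint_linear _ _ (adjoint_sym _ _ HS)) as HSl.
  apply (hlim_ext (fun N => S (comb (E n) e N))); [intros N; apply comb_linear; auto |].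
  replace (e n) with (S (r n)).
  - apply (hlim_linear S M); auto; apply (adjoint_bound A S); auto.
  - apply hinner_ext; intros x; rewrite (adjoint_sym _ _ HS).
    rewrite (hinner_conj H (A x)), HAr, <- hinner_conj; auto.
Qed.

(** * Sums of three unitaries *)

Lemma hnorm_scal_real a (x : H) : 0 <= a -> |[RtoC a [*] x]| = a * |[x]|.
Proof. intros Ha; rewrite hnorm_scal, Cmod_R, Rabs_pos_eq; auto. Qed.

Lemma operator_limit (Y : nat -> H -> H) K q : complete H -> 0 <= K -> 0 <= q < 1 ->
  (forall n x, |[Y (S n) x [-] Y n x]| <= K * q ^ n * |[x]|) ->
  exists Z, forall x, hlim (fun n => Y n x) (Z x) /\
    forall n, |[Z x [-] Y n x]| <= K / (1 - q) * q ^ n * |[x]|.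
Proof.
  intros Hc HK Hq HY.
  destruct (ClassicalEpsilon.choice (fun x l => hlim (fun n => Y n x) l /\
    forall n, |[l [-] Y n x]| <= K / (1 - q) * q ^ n * |[x]|)) as [Z HZ]; [| exists Z; auto].
  intros x; destruct (geometric_limit (fun n => Y n x) (K * |[x]|) q) as [l [Hl Hb]]; auto.
  - apply Rmult_le_pos; auto; apply hnorm_pos.
  - intros n; specialize (HY n x); lra.
  - exists l; split; auto; intros n; specialize (Hb n).
    replace (K / (1 - q) * q ^ n * |[x]|) with (K * |[x]| / (1 - q) * q ^ n) by (field; lra); auto.
Qed.

(* [Y] is fixed by this map exactly when [3 (1 - Y)^2 (1 + R) = 3 - R]. *)
Definition sqrt_step (R Y : H -> H) (x : H) : H :=
  RtoC (/ 2) [*] (Y (Y x) [-] RtoC 2 [*] Y (R x) [+] Y (Y (R x)) [+] RtoC (4 / 3) [*] R x).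

(** The difference of squares splits as [(Y - Z) Y + Z (Y - Z)], of norm at most [d / 2]. The three
    terms then give [(d / 2 + d / 5 + d / 20) / 2], below [d / 2]. *)
Lemma sqrt_step_contraction R Y Z d : 0 <= d ->
  (forall x, |[R x]| <= / 10 * |[x]|) ->
  linear_map Z -> (forall x, |[Y x]| <= / 4 * |[x]|) -> (forall x, |[Z x]| <= / 4 * |[x]|) ->
  (forall x, |[Y x [-] Z x]| <= d * |[x]|) ->
  forall x, |[sqrt_step R Y x [-] sqrt_step R Z x]| <= / 2 * d * |[x]|.
Proof.
  intros Hd HR HZl HY HZ HYZ x.
  assert (Hsq : forall w, |[Y (Y w) [-] Z (Z w)]| <= / 2 * d * |[w]|).
  { intros w; eapply Rle_trans; [apply (hnorm_sub_triangle (Z (Y w))) |].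
    rewrite <- (linear_map_sub Z) by auto.
    pose proof (HYZ (Y w)); pose proof (HZ (Y w [-] Z w)).
    pose proof (Rmult_le_compat_l d _ _ Hd (HY w)); pose proof (HYZ w); lra. }
  unfold sqrt_step.
  replace (_ [-] _) with (RtoC (/ 2) [*] ((Y (Y x) [-] Z (Z x)) [-]
    RtoC 2 [*] (Y (R x) [-] Z (R x)) [+] (Y (Y (R x)) [-] Z (Z (R x))))) by hilb.
  rewrite hnorm_scal_real by lra.
  pose proof (hnorm_triangle ((Y (Y x) [-] Z (Z x)) [-] RtoC 2 [*] (Y (R x) [-] Z (R x)))
    (Y (Y (R x)) [-] Z (Z (R x)))) as H1.
  pose proof (hnorm_sub_le (Y (Y x) [-] Z (Z x)) (RtoC 2 [*] (Y (R x) [-] Z (R x)))) as H2.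
  rewrite hnorm_scal_real in H2 by lra.
  pose proof (Hsq x); pose proof (Hsq (R x)); pose proof (HYZ (R x)).
  pose proof (Rmult_le_compat_l d _ _ Hd (HR x)).
  pose proof (Rmult_le_pos _ _ Hd (hnorm_pos x)); lra.
Qed.

Lemma sqrt_step_bound R Y : (forall x, |[R x]| <= / 10 * |[x]|) ->
  (forall x, |[Y x]| <= / 4 * |[x]|) -> forall x, |[sqrt_step R Y x]| <= / 4 * |[x]|.
Proof.
  intros HR HY x; unfold sqrt_step; rewrite hnorm_scal_real by lra.
  pose proof (hnorm_triangle (Y (Y x) [-] RtoC 2 [*] Y (R x) [+] Y (Y (R x)))
    (RtoC (4 / 3) [*] R x)) as H1.
  pose proof (hnorm_triangle (Y (Y x) [-] RtoC 2 [*] Y (R x)) (Y (Y (R x)))) as H2.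
  pose proof (hnorm_sub_le (Y (Y x)) (RtoC 2 [*] Y (R x))) as H3.
  rewrite hnorm_scal_real in H1, H3 by lra.
  pose proof (HY x); pose proof (HY (Y x)); pose proof (HY (R x)); pose proof (HY (Y (R x))).
  pose proof (HR x); pose proof (hnorm_pos x); lra.
Qed.

Lemma sqrt_step_adjoint R Y : adjoint R R -> adjoint Y Y -> (forall x, Y (R x) = R (Y x)) ->
  adjoint (sqrt_step R Y) (sqrt_step R Y).
Proof.
  intros HR HY HYR x y; unfold sqrt_step; repeat progress inner_simpl.
  rewrite !Cconj_RtoC, !HY, !HR, !HYR; ring.
Qed.

Lemma sqrt_step_commute R Y : linear_map R -> (forall x, Y (R x) = R (Y x)) ->
  forall x, sqrt_step R Y (R x) = R (sqrt_step R Y x).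
Proof.
  intros HR HYR x; unfold sqrt_step; destruct HR as [Ha Hs].
  rewrite Hs, !Ha, Hs, linear_map_sub, Hs, <- !HYR by (split; auto); reflexivity.
Qed.

(** Iteration from [0]. Self-adjointness, commutation with [R] and the bound [/ 4] are preserved at
    each step and pass to the pointwise limit. *)
Lemma sqrt_step_fixpoint R : complete H -> adjoint R R -> (forall x, |[R x]| <= / 10 * |[x]|) ->
  exists Y, adjoint Y Y /\ (forall x, Y (R x) = R (Y x)) /\ forall x, sqrt_step R Y x = Y x.
Proof.
  intros Hc HRa HR; pose proof (adjoint_linear _ _ HRa) as HRl.
  set (Y := fix Y n := match n with
    | O => fun _ => hzero H
    | S m => sqrt_step R (Y m) end).
  assert (HY : forall n, adjoint (Y n) (Y n) /\ (forall x, Y n (R x) = R (Y n x)) /\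
    forall x, |[Y n x]| <= / 4 * |[x]|).
  { induction n as [| n [IHa [IHc IHb]]]; simpl; repeat split.
    - intros x y; rewrite hinner_zero_l, hinner_zero_r; auto.
    - intros x; rewrite linear_map_zero; auto.
    - intros x; rewrite hnorm_zero; pose proof (hnorm_pos x); lra.
    - apply sqrt_step_adjoint; auto.
    - apply sqrt_step_commute; auto.
    - apply sqrt_step_bound; auto. }
  assert (HYl : forall n, linear_map (Y n)) by (intros n; apply (adjoint_linear _ (Y n)), HY).
  destruct (operator_limit Y 1 (/ 2)) as [Z HZ]; auto; try lra.
  { induction n as [| n IH]; intros x.
    - simpl; replace (_ [-] _) with (Y 1%nat x) by (simpl; hilb).
      pose proof (proj2 (proj2 (HY 1%nat)) x); pose proof (hnorm_pos x); lra.
    - change (Y (S (S n))) with (sqrt_step R (Y (S n))).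
      change (Y (S n) x) with (sqrt_step R (Y n) x).
      eapply Rle_trans; [apply (sqrt_step_contraction R (Y (S n)) (Y n) (1 * (/ 2) ^ n)) |];
        auto; try apply HY.
      + rewrite Rmult_1_l; apply pow_le; lra.
      + simpl; lra. }
  assert (HZb : forall x, |[Z x]| <= / 4 * |[x]|).
  { intros x; apply (hlim_norm_le (fun n => Y n x)); [apply HZ | intros n; apply HY]. }
  exists Z; repeat split.
  - intros x y; apply (clim_unique (fun n => <|Y n x, y|>)); [apply hlim_inner, HZ |].
    apply (clim_ext (fun n => Cconj <|Y n y, x|>)).
    + intros n; rewrite <- hinner_conj; symmetry; apply HY.
    + apply (is_lim_seq_ext (fun n => Cmod (Cminus <|Y n y, x|> <|Z y, x|>))).
      * intros n; rewrite (hinner_conj H (Z y) x), <- Cminus_conj, Cmod_conj; auto.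
      * apply (hlim_inner (fun n => Y n y)), HZ.
  - intros x; apply (hlim_unique (fun n => Y n (R x))); [apply HZ |].
    apply (hlim_ext (fun n => R (Y n x))); [intros n; symmetry; apply HY |].
    apply (hlim_linear R (/ 10)); auto; apply HZ.
  (* The iterates [Y (S n)] tend to [sqrt_step R Z] as well, by the contraction estimate with [d]
     equal to the known distance [2 * (/ 2) ^ n] from [Z] to [Y n]. *)
  - intros x; apply (hlim_unique (fun n => Y (S n) x)).
    + eapply hlim_le; [intros n |].
      * change (Y (S n) x) with (sqrt_step R (Y n) x); rewrite hnorm_sub_sym.
        apply (sqrt_step_contraction R Z (Y n) (1 / (1 - / 2) * (/ 2) ^ n)); auto.
        -- apply Rmult_le_pos; [lra | apply pow_le; lra].
        -- apply HY.
        -- intros w; apply HZ.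
      * apply (is_lim_seq_ext (fun n => |[x]| * (/ 2) ^ n)); [intros n; field |].
        apply is_lim_seq_0_scal, is_lim_seq_geom; rewrite Rabs_pos_eq; lra.
    + apply (hlim_incr (fun n => Y n x)), HZ.
Qed.

(** The iterates [u] are the partial sums of the Neumann series of [1 + X] at [y]; the relation
    [u (S n) + X (u n) = y] passes to the limit. *)
Lemma neumann_surjective X : complete H -> linear_map X -> (forall x, |[X x]| <= / 30 * |[x]|) ->
  forall y, exists z, z [+] X z = y.
Proof.
  intros Hc HXl HX y.
  set (u := fix u n := match n with O => y | S m => y [-] X (u m) end).
  destruct (geometric_limit u (/ 30 * |[y]|) (/ 30)) as [z [Hz _]]; auto; try lra.
  { pose proof (hnorm_pos y); lra. }
  { induction n as [| n IH].
    - simpl; replace (y [-] X y [-] y) with (Copp (RtoC 1) [*] X y) by hilb.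
      rewrite hnorm_scal, Cmod_opp, Cmod_1; pose proof (HX y); lra.
    - change (u (S (S n))) with (y [-] X (u (S n))).
      replace (y [-] X (u (S n)) [-] u (S n)) with (X (u n) [-] X (u (S n)))
        by (change (u (S n)) with (y [-] X (u n)) at 3; hilb).
      rewrite hnorm_sub_sym, <- linear_map_sub by auto.
      eapply Rle_trans; [apply HX |]; cbn [pow]; lra. }
  exists z; apply (hlim_unique (fun n => u (S n) [+] X (u n))).
  - apply hlim_add; [apply (hlim_incr u); auto | apply (hlim_linear X (/ 30)); auto].
  - apply (hlim_ext (fun _ => y)).
    + intros n; change (u (S n)) with (y [-] X (u n)); hilb.
    + apply hlim_of_eps; intros eps Heps; exists 0%nat; intros n _.
      replace (y [-] y) with (hzero H) by hilb; rewrite hnorm_zero; auto.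
Qed.

Definition unitary (U : H -> H) : Prop :=
  (forall x y, <|U x, U y|> = <|x, y|>) /\ surjective H U.

Lemma unitary_onb U e : unitary U -> onb e -> onb (fun n => U (e n)).
Proof.
  intros [HU Hs] [Ho Ht]; split.
  - intros n k; rewrite HU; apply Ho.
  - intros x Hx; destruct (Hs x) as [w Hw].
    assert (Hw0 : w = hzero H).
    { apply Ht; intros n; rewrite <- HU, Hw; auto. }
    apply hinner_def; rewrite <- Hw at 1 2; rewrite HU, Hw0, hinner_zero_l; auto.
Qed.

(* [s] stands for [i] or [-i]; [U = V (1 + s K)] with [V = (1 + X) / 2] is unitary because
   [V* V = (1 + R) / 4] and [(1 + K^2) (1 + R) = 4]. *)
Lemma unitary_factor (X X' K : H -> H) (s : C) : complete H ->
  adjoint X X' -> adjoint K K -> (forall x, |[X x]| <= / 30 * |[x]|) ->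
  Cconj s = Copp s -> Cmult s s = Copp (RtoC 1) ->
  (forall x, K (X x [+] X' x [+] X' (X x)) = X (K x) [+] X' (K x) [+] X' (X (K x))) ->
  (forall x, x [+] (X x [+] X' x [+] X' (X x)) [+]
    (K (K x) [+] (X (K (K x)) [+] X' (K (K x)) [+] X' (X (K (K x))))) = RtoC 4 [*] x) ->
  unitary (fun x => RtoC (/ 2) [*] ((x [+] s [*] K x) [+] X (x [+] s [*] K x))).
Proof.
  intros Hc HX HK HXb Hs1 Hs2 Hcomm Heq.
  set (R := fun x => X x [+] X' x [+] X' (X x)) in *.
  assert (HXl := adjoint_linear _ _ HX).
  assert (HX'l := adjoint_linear _ _ (adjoint_sym _ _ HX)).
  assert (HKl := adjoint_linear _ _ HK).
  assert (HRl : linear_map R).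
  { split; intros; unfold R;
      rewrite ?(proj1 HXl), ?(proj2 HXl), ?(proj1 HX'l), ?(proj2 HX'l); hilb. }
  change (forall x, K (R x) = R (K x)) in Hcomm.
  change (forall x, x [+] R x [+] (K (K x) [+] R (K (K x))) = RtoC 4 [*] x) in Heq.
  destruct HKl as [Ka Ks]; destruct HRl as [Ra Rs].
  split.
  - intros x y; set (w := x [+] s [*] K x).
    (* As [K] commutes with [R] and [s^2 = -1], this is [(1 - s K)(1 + s K)(1 + R) = (1 + K^2)(1 +
       R) = 4] applied to [x]. *)
    assert (Hw : (w [+] R w) [-] s [*] K (w [+] R w) = RtoC 4 [*] x).
    { rewrite <- Heq; unfold w; repeat progress rewrite ?Ka, ?Ra, ?Ks, ?Rs, ?Hcomm.
      hilb; ring [Hs2]. }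
    set (w' := y [+] s [*] K y).
    assert (HV : <|w [+] X w, w' [+] X w'|> = <|w [+] R w, w'|>).
    { unfold R; repeat progress inner_simpl.
      rewrite (adjoint_sym _ _ HX (X w) w'), (adjoint_sym _ _ HX w w'); ring. }
    rewrite hinner_scal_l, hinner_scal_r, Cconj_RtoC, HV.
    transitivity (Cmult (Cmult (RtoC (/ 2)) (RtoC (/ 2))) <|RtoC 4 [*] x, y|>).
    + rewrite <- Hw; unfold w' at 1; repeat progress inner_simpl.
      rewrite !HK, !Hs1; inner_simpl; ring.
    + rewrite hinner_scal_l, Cmult_assoc, <- !RtoC_mult.
      replace (/ 2 * / 2 * 4) with 1 by field; ring.
  - intros y.
    (* First [(1 + X) z = 2 y] is solved; then [(1 - s K)(1 + R) / 4] inverts [1 + s K]. *)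
    destruct (neumann_surjective X Hc HXl HXb (RtoC 2 [*] y)) as [z Hz].
    set (u := z [+] R z).
    exists (RtoC (/ 4) [*] (u [-] s [*] K u)).
    replace (RtoC (/ 4) [*] (u [-] s [*] K u) [+] s [*] K (RtoC (/ 4) [*] (u [-] s [*] K u)))
      with z.
    + rewrite Hz, hscal_assoc, <- RtoC_mult.
      replace (/ 2 * 2) with 1 by field; apply hscal_one.
    + transitivity (RtoC (/ 4) [*] (RtoC 4 [*] z)).
      { rewrite hscal_assoc, <- RtoC_mult; replace (/ 4 * 4) with 1 by field.
        rewrite hscal_one; auto. }
      rewrite <- Heq, Ks, (linear_map_sub K), Ks by (split; auto).
      unfold u; repeat progress rewrite ?Ka, ?Hcomm.
      hilb; ring [Hs2].
Qed.

(** Provides two of the three unitaries: in the sum of the factors for [s = i] and [s = -i] the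
    terms in [K] cancel. *)
Lemma three_unitaries (X X' : H -> H) : complete H -> adjoint X X' ->
  (forall x, |[X x]| <= / 30 * |[x]|) ->
  exists U1 U2, unitary U1 /\ unitary U2 /\ forall x, U1 x [+] U2 x = x [+] X x.
Proof.
  intros Hc HX HXb.
  assert (HX'b : forall x, |[X' x]| <= / 30 * |[x]|) by (apply (adjoint_bound X); auto; lra).
  set (R := fun x => X x [+] X' x [+] X' (X x)).
  assert (HRa : adjoint R R).
  { intros x y; unfold R; repeat progress inner_simpl.
    rewrite !HX, !(adjoint_sym _ _ HX), !HX; ring. }
  destruct (sqrt_step_fixpoint R Hc HRa) as [Y [HYa [HYR HYe]]].
  (* The bound [/ 30] on [X] is chosen for this: [1/30 + 1/30 + 1/900 < 1/10]. *)
  { intros x; unfold R.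
    pose proof (hnorm_triangle (X x [+] X' x) (X' (X x))).
    pose proof (hnorm_triangle (X x) (X' x)).
    pose proof (HXb x); pose proof (HX'b x); pose proof (HX'b (X x)).
    pose proof (hnorm_pos x); lra. }
  pose proof (adjoint_linear _ _ HYa) as [Ya Ys]; pose proof (adjoint_linear _ _ HRa) as [Ra Rs].
  set (K := fun x => RtoC (sqrt 3) [*] (x [-] Y x)).
  assert (HKa : adjoint K K).
  { intros x y; unfold K; repeat progress inner_simpl; rewrite Cconj_RtoC, HYa; ring. }
  assert (HKR : forall x, K (R x) = R (K x)).
  { intros x; unfold K; rewrite Rs, (linear_map_sub R), HYR by (split; auto); auto. }
  assert (HKe : forall x, x [+] R x [+] (K (K x) [+] R (K (K x))) = RtoC 4 [*] x).
  { assert (HKK : forall x, K (K x) = RtoC 3 [*] (x [-] RtoC 2 [*] Y x [+] Y (Y x))).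
    { intros x; unfold K; rewrite Ys, (linear_map_sub Y) by (split; auto).
      assert (H3 : Cmult (RtoC (sqrt 3)) (RtoC (sqrt 3)) = RtoC 3)
        by (rewrite <- RtoC_mult, sqrt_sqrt; auto; lra).
      hilb; ring [H3]. }
    intros x; rewrite <- !HKR, !HKK.
    assert (H4 : RtoC 6 [*] sqrt_step R Y x = RtoC 6 [*] Y x) by (rewrite HYe; auto).
    unfold sqrt_step in H4.
    apply hinner_ext; intros z; apply (f_equal (fun v => <|v, z|>)) in H4.
    repeat progress (rewrite ?hinner_add_l, ?hinner_sub_l, ?hinner_scal_l in H4).
    repeat progress inner_simpl.
    assert (H2 : Cmult (RtoC 6) (RtoC (/ 2)) = RtoC 3) by (rewrite <- RtoC_mult; f_equal; field).
    assert (H3 : Cmult (RtoC 3) (RtoC (4 / 3)) = RtoC 4) by (rewrite <- RtoC_mult; f_equal; field).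
    rewrite Cmult_assoc, H2 in H4.
    (* The goal's left side is [4 <|x, z|>] plus the difference of the two sides of the fixed point
       equation multiplied by 6. *)
    match type of H4 with ?l = ?r =>
      transitivity (Cplus (Cmult (RtoC 4) <|x, z|>) (Cminus l r)); [ring [H3] | rewrite H4; ring]
    end. }
  destruct (unitary_factor X X' K Ci Hc HX HKa HXb) as [U1i U1s]; auto.
  { unfold Ci, Cconj, Copp; simpl; f_equal; ring. }
  { unfold Ci, Cmult, Copp, RtoC; simpl; f_equal; ring. }
  destruct (unitary_factor X X' K (Copp Ci) Hc HX HKa HXb) as [U2i U2s]; auto.
  { unfold Ci, Cconj, Copp; simpl; f_equal; ring. }
  { unfold Ci, Cmult, Copp, RtoC; simpl; f_equal; ring. }
  eexists; eexists; split; [split; [exact U1i | exact U1s] |].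
  split; [split; [exact U2i | exact U2s] |].
  intros x; simpl.
  destruct (adjoint_linear _ _ HX) as [Xa Xs]; rewrite !Xa, !Xs.
  hilb; rewrite RtoC_inv by lra; field; intros E0; injection E0; lra.
Qed.

(** * Norms of homotheties and the synthesis operator *)

Lemma opnorm_scal (h : H) t : 0 <= t -> |[h]| = 1 -> opnorm H (fun x => RtoC t [*] x) = t.
Proof.
  intros Ht Hh; unfold opnorm.
  rewrite (is_lub_Rbar_unique _ t); auto; split.
  - intros r [x [Hx ->]]; simpl; rewrite hnorm_scal_real by auto; pose proof (hnorm_pos x); nra.
  - intros b Hb; apply Hb; exists h; split; [lra |].
    rewrite hnorm_scal_real, Hh by auto; ring.
Qed.

(** [S] is obtained as the adjoint of the analysis map [P], whose coordinates at [x] are the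
    [<|x, u n|>]; the closed graph argument supplies the bound [M]. *)
Lemma synthesis_operator (e u : nat -> H) : complete H -> onb e ->
  (forall x, ex_series (fun n => Cmod <|x, u n|> ^ 2)) ->
  exists S P M, adjoint S P /\ 0 <= M /\ (forall x, |[S x]| <= M * |[x]|) /\
    forall n, S (e n) = u n.
Proof.
  intros Hc He Hu.
  destruct (ClassicalEpsilon.choice (fun x y => forall n, <|y, e n|> = <|x, u n|>)) as [P HP].
  { intros x.
    destruct (riesz_fischer (fun n => <|x, u n|>) e (Series (fun n => Cmod <|x, u n|> ^ 2)))
      as [y [_ Hy]]; auto; [apply He | | exists y; auto].
    intros N; apply rsum_le_Series; auto; intros; apply pow2_ge_0. }
  destruct (total_image_bounded P e u Hc (proj2 He) HP) as [HPl [M [HM HPM]]].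
  destruct (adjoint_exists e P M Hc He HPl HPM) as [S HS].
  exists S, P, M; split; [apply adjoint_sym; auto |]; split; auto; split.
  - apply (adjoint_bound P S); auto.
  - intros n; apply hinner_ext; intros x.
    rewrite (adjoint_sym _ _ HS), (hinner_conj H (P x)), HP, <- hinner_conj; auto.
Qed.

End Hilbert.

Theorem theorem2p9 (H : HilbertSpace)
  (Hcomplete : complete H) (Hsep : separable H) (Hinf : infinite_dimensional H)
  (E : nat -> nat -> C) (HE : invertible_matrix_mapping H E)
  (f : nat -> H) (Hf : E_frame H E f)
  (eps : R) (Heps : 0 < eps < 1) :
  exists T : H -> H, bounded_linear H T /\ surjective H T /\
  exists g1 g2 g3 : nat -> H,
    E_orthonormal_basis H E g1 /\ E_orthonormal_basis H E g2 /\
    E_orthonormal_basis H E g3 /\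
    forall Ef Eg1 Eg2 Eg3 : nat -> H,
      mat_apply H E f Ef -> mat_apply H E g1 Eg1 ->
      mat_apply H E g2 Eg2 -> mat_apply H E g3 Eg3 ->
      forall n, Ef n =
        hscal H (RtoC (opnorm H T / (1 - eps)))
          (hadd H (hadd H (Eg1 n) (Eg2 n)) (Eg3 n)).
Proof.
  destruct (onb_exists Hsep Hinf) as [e He].
  destruct Hf as [u [Hu [A [B [_ [_ HAB]]]]]].
  destruct (synthesis_operator e u Hcomplete He (fun x => proj1 (HAB x)))
    as [S [P [M [HSP [HM [HSM HSe]]]]]].
  (* Brings [S / l] below norm [/ 30]; the [+ 1] keeps [l] positive when [M = 0]. *)
  set (l := 30 * (M + 1)).
  assert (Hl : 0 < l) by (unfold l; lra).
  assert (Hil : 0 < / l) by (apply Rinv_0_lt_compat; auto).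
  destruct (three_unitaries (fun x => hscal H (RtoC (/ l)) (S x))
    (fun x => hscal H (RtoC (/ l)) (P x))) as [U1 [U2 [HU1 [HU2 HU]]]]; auto.
  { intros x y; rewrite hinner_scal_l, hinner_scal_r, Cconj_RtoC, HSP; auto. }
  { intros x; rewrite hnorm_scal_real by lra.
    apply (Rmult_le_reg_l l); auto; rewrite <- Rmult_assoc, Rinv_r, Rmult_1_l by lra.
    eapply Rle_trans; [apply HSM |]; unfold l; pose proof (hnorm_pos x); lra. }
  (* The third unitary cancels the identity in [U1 + U2 = 1 + S / l]. *)
  assert (Hneg : unitary (fun x => hscal H (Copp (RtoC 1)) x)).
  { split.
    - intros x y; inner_simpl; rewrite Copp_conj, Cconj_RtoC; ring.
    - intros y; exists (hscal H (Copp (RtoC 1)) y); hilb. }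
  pose proof (unitary_onb _ _ HU1 He) as He1; pose proof (unitary_onb _ _ HU2 He) as He2.
  pose proof (unitary_onb _ _ Hneg He) as He3.
  destruct (onb_matrix_preimage E _ Hcomplete He1 HE) as [g1 Hg1].
  destruct (onb_matrix_preimage E _ Hcomplete He2 HE) as [g2 Hg2].
  destruct (onb_matrix_preimage E _ Hcomplete He3 HE) as [g3 Hg3].
  (* With [T] equal to [t] times the identity, the factor [opnorm H T / (1 - eps)] is exactly
     [l]. *)
  set (t := l * (1 - eps)).
  assert (Ht : 0 < t) by (apply Rmult_lt_0_compat; lra).
  exists (fun x => hscal H (RtoC t) x); split; [| split].
  - split; [| split].
    + intros x y; hilb.
    + intros a x; hilb.
    + exists t; intros x; rewrite hnorm_scal_real; lra.
  - intros y; exists (hscal H (RtoC (/ t)) y).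
    rewrite hscal_assoc, <- RtoC_mult, Rinv_r, hscal_one by lra; auto.
  - exists g1, g2, g3.
    split; [apply (onb_E_orthonormal_basis E g1 _ Hcomplete He1 Hg1) |].
    split; [apply (onb_E_orthonormal_basis E g2 _ Hcomplete He2 Hg2) |].
    split; [apply (onb_E_orthonormal_basis E g3 _ Hcomplete He3 Hg3) |].
    intros Ef Eg1 Eg2 Eg3 HEf HE1 HE2 HE3 n.
    rewrite (mat_apply_unique _ _ _ _ HEf Hu), (mat_apply_unique _ _ _ _ HE1 Hg1).
    rewrite (mat_apply_unique _ _ _ _ HE2 Hg2), (mat_apply_unique _ _ _ _ HE3 Hg3).
    rewrite HU, HSe.
    rewrite (opnorm_scal (e 0%nat) t) by (try lra; apply orthonormal_norm, He).
    replace (t / (1 - eps)) with l by (unfold t; field; lra).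
    assert (Hll : Cmult (RtoC l) (RtoC (/ l)) = RtoC 1)
      by (rewrite <- RtoC_mult, Rinv_r; auto; lra).
    hilb; ring [Hll].
Qed.
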